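(* Let $0<\alpha\le2$. Let $\mu$ be a real number and define $(p_k)_{k\in\mathbb{Z}}$ as follows. If $0<\alpha<2$ and $\alpha\ne1$: assume $0<\mu\le\frac{\cos(\alpha\pi/2)}{1-\alpha}$ and set $$p_0=1-2\mu\,\frac{1-\alpha}{2\cos(\alpha\pi/2)},\qquad p_k=(-1)^k\frac{\mu}{2\cos(\alpha\pi/2)}\binom{\alpha}{|k|+1}\quad(k\neq0).$$ If $\alpha=1$: assume $0<\mu\le\pi/2$ and set $$p_0=1-\frac{2\mu}{\pi},\qquad p_k=\frac{\mu}{\pi|k|(|k|+1)}\quad(k\ne0).$$ If $\alpha=2$: assume $0<\mu\le1/2$ and set $$p_0=1-2\mu,\qquad p_1=p_{-1}=\mu,\qquad p_k=0\quad(|k|\ge2).$$ Let $Y_1,Y_2,\dots$ be independent identically distributed $\mathbb{Z}$-valued random variables with $P(Y_m=k)=p_k$ for all $k\in\mathbb{Z}$. Fix $t>0$. For each $n\in\mathbb{N}$ put $\tau=t/n$, let $h=h_n>0$ be determined by the scaling relation $\tau=\mu h^\alpha$, and let $$S_n=h_n\sum_{m=1}^nY_m.$$ Then, as $n\to\infty$, $S_n$ converges in distribution to the random variable $S(t)$ whose probability density is $g_\alpha(\cdot,t;0)$.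
   Context: For $0<\alpha\le 2$ and $t>0$, $g_\alpha(x,t;0)=\frac{1}{2\pi}\int_{-\infty}^{+\infty}e^{-i\kappa x}\exp(-t|\kappa|^\alpha)\,d\kappa$ ($x\in\mathbb{R}$) is the symmetric stable probability density with characteristic function $\int_{-\infty}^{+\infty}e^{i\kappa x}g_\alpha(x,t;0)\,dx=\exp(-t|\kappa|^\alpha)$, $\kappa\in\mathbb{R}$. $S(t)$ denotes a random variable with this density. For real $\alpha$ and integer $k\ge 0$, $\binom{\alpha}{k}=\alpha(\alpha-1)\cdots(\alpha-k+1)/k!$ is the generalized binomial coefficient. *)

(* Defs.v *)
From HB Require Import structures.
From mathcomp Require Import all_boot all_order all_algebra finmap.
From mathcomp Require Import complex.
From mathcomp Require Import all_classical all_reals all_analysis measurable_realfun.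

Set Implicit Arguments.
Unset Strict Implicit.
Unset Printing Implicit Defensive.

Import Order.TTheory GRing.Theory Num.Theory.
Import numFieldNormedType.Exports.

Local Open Scope classical_set_scope.
Local Open Scope ring_scope.

HB.instance Definition _ := isPointed.Build int 0.

HB.instance Definition _ := @isMeasurable.Build default_measure_display
  int discrete_measurable discrete_measurable0
  discrete_measurableC discrete_measurableU.

Definition gen_binomial (R : realType) (a : R) (k : nat) : R :=
  (\prod_(i < k) (a - i%:R)) / k`!%:R.

Definition step_bound (R : realType) (alpha : R) : R :=
  if alpha == 1 then pi / 2
  else if alpha == 2 then 2^-1
  else cos (alpha * pi / 2) / (1 - alpha).

Definition step_prob (R : realType) (alpha mu : R) (k : int) : R :=
  if alpha == 1 then
    if k == 0 then 1 - 2 * mu / pi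
    else mu / (pi * (`|k|%N)%:R * (`|k|%N.+1)%:R)
  else if alpha == 2 then
    if k == 0 then 1 - 2 * mu
    else if `|k|%N == 1%N then mu
    else 0
  else
    if k == 0 then 1 - 2 * mu * ((1 - alpha) / (2 * cos (alpha * pi / 2)))
    else (-1) ^+ `|k|%N * (mu / (2 * cos (alpha * pi / 2)))
         * gen_binomial alpha `|k|%N.+1.

Definition complex_integral (R : realType) (f : R -> R[i]) : R[i] :=
  Complex (\int[lebesgue_measure]_x complex.Re (f x))%R
          (\int[lebesgue_measure]_x complex.Im (f x))%R.

Definition cis (R : realType) (y : R) : R[i] := Complex (cos y) (sin y).

Definition stable_integral (R : realType) (alpha t x : R) : R[i] :=
  ((2 * pi)^-1)%:C%C * complex_integral (fun kappa : R =>
    cis (- (kappa * x)) * (expR (- (t * `|kappa| `^ alpha)))%:C%C).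

(* The Fourier integral is real-valued: see stable_densityE below. *)
Definition stable_density (R : realType) (alpha t x : R) : R :=
  complex.Re (stable_integral alpha t x).

Lemma ge0_integral_reflect (R : realType) (f : R -> \bar R) :
  measurable_fun setT f -> (forall x, (0 <= f x)%E) ->
  (\int[lebesgue_measure]_x f (- x)%R = \int[lebesgue_measure]_x f x)%E.
Proof.
move=> mf f0.
have mfN : measurable_fun setT (fun x : R => f (- x)).
  exact: (measurableT_comp mf (@oppr_measurable R setT)).
have split_at0 (g : R -> \bar R) : measurable_fun setT g ->
    (forall x, (0 <= g x)%E) ->
    (\int[lebesgue_measure]_x g x =
     \int[lebesgue_measure]_(x in `]-oo, 0%R]) g x +
     \int[lebesgue_measure]_(x in `[0%R, +oo[) g x)%E.
  move=> mg g0; rewrite -[in RHS]integral_itv_obnd_cbnd; last first.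
    exact: measurable_funTS.
  rewrite -ge0_integral_setU//=.
  - by rewrite -itv_bndbnd_setU// set_itvNyy.
  - exact: measurable_funTS.
  - by apply: lt_disjoint => x y; rewrite !in_itv/= andbT => /le_lt_trans; apply.
rewrite !split_at0// addeC; congr (_ + _)%E.
  by rewrite ge0_integration_by_substitution0//; under eq_integral do rewrite opprK.
by rewrite -ge0_integration_by_substitution0.
Qed.

Lemma Rintegral_odd (R : realType) (f : R -> R) :
  measurable_fun setT f -> (forall x, f (- x) = - f x) ->
  (\int[lebesgue_measure]_x f x = 0)%R.
Proof.
move=> mf fN; rewrite /Rintegral integralE.
rewrite -(ge0_integral_reflect (f := ((EFin \o f)^\-)%E)) //; last first.
  by apply: measurable_funeneg; exact/measurable_EFinP.
under [X in (_ - X)%E]eq_integral => x _.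
  rewrite (_ : ((EFin \o f)^\-)%E (- x) = ((EFin \o f)^\+)%E x); last first.
    by rewrite funenegE funeposE /= fN opprK.
  over.
by case: (integral _ _ _) => //= r; rewrite subrr.
Qed.

Lemma stable_densityE (R : realType) (alpha t x : R) :
  stable_integral alpha t x = (stable_density alpha t x)%:C%C.
Proof.
rewrite /stable_density /stable_integral /complex_integral; simpc.
congr Complex => /=.
rewrite Rintegral_odd ?mulr0// => [|k]; last first.
  by rewrite normrN mulNr !sinN !mulr0 !add0r mulNr.
rewrite /=; apply: measurable_funD; apply: measurable_funM => //.
- apply: (measurableT_comp (continuous_measurable_fun (@continuous_cos R))).
  by apply: measurable_funN; exact: measurable_funM.
- apply: (measurableT_comp (continuous_measurable_fun (@continuous_sin R))).
  by apply: measurable_funN; exact: measurable_funM.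
- apply: (measurableT_comp (@measurable_expR R)).
  apply: measurable_funN; apply: measurable_funM => //.
  exact: (measurableT_comp (measurable_powR alpha) (@normr_measurable R setT)).
Qed.

Definition has_density (R : realType) (d : measure_display)
    (T : measurableType d) (P : probability T R) (X : {RV P >-> R})
    (f : R -> R) : Prop :=
  [/\ measurable_fun setT f, forall x, 0 <= f x &
      forall A : set R, measurable A ->
        (distribution P X A = \int[lebesgue_measure]_(x in A) (f x)%:E)%E].

Definition mutually_independent (R : realType) (d d' : measure_display)
    (T : measurableType d) (T' : measurableType d') (P : probability T R)
    (X : nat -> {RV P >-> T'}) : Prop :=
  forall (J : {fset nat}) (B : nat -> set T'),
    (forall j, measurable (B j)) ->
    (P (\bigcap_(j in [set` J]) (X j @^-1` B j))
     = \prod_(j <- J) P (X j @^-1` B j))%E.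

Definition cvg_in_distribution (R : realType) (d d' : measure_display)
    (T : measurableType d) (T' : measurableType d')
    (P : probability T R) (P' : probability T' R)
    (X : nat -> {RV P >-> R}) (Z : {RV P' >-> R}) : Prop :=
  forall x : R, {for x, continuous (cdf Z)} ->
    cdf (X n) x @[n --> \oo] --> cdf Z x.

(* Indices are shifted: Y m stands for the (m+1)-st step. *)
Definition scaled_walk (R : realType) (d : measure_display)
    (T : measurableType d) (P : probability T R)
    (h : R) (Y : nat -> {RV P >-> int}) (n : nat) : T -> R :=
  fun w => h * (\sum_(m < n) Y m w)%:~R.

Lemma measurable_scaled_walk (R : realType) (d : measure_display)
    (T : measurableType d) (P : probability T R)
    (h : R) (Y : nat -> {RV P >-> int}) (n : nat) :
  measurable_fun setT (scaled_walk h Y n).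
Proof.
rewrite /scaled_walk; apply: measurable_funM => //.
under eq_fun do rewrite rmorph_sum.
apply: measurable_sum => m.
have mc : measurable_fun setT (fun k : int => k%:~R : R) by [].
exact: (measurableT_comp mc).
Qed.

HB.instance Definition _ (R : realType) (d : measure_display)
    (T : measurableType d) (P : probability T R)
    (h : R) (Y : nat -> {RV P >-> int}) (n : nat) :=
  isMeasurableFun.Build d _ T R (scaled_walk h Y n)
    (measurable_scaled_walk h Y n).

(* Main.v *)
(* Let [c(s) = \sum_k p_k cos(k s)].  By independence the characteristic
   function of [S_n] at [k] is [c(k h_n)^n], so the asymptotics
   [1 - c(s) ~ mu |s|^alpha] at [0] and the scaling relation give its limit
   [exp(-t |k|^alpha)].  The recurrence
   [(j+3) p_(j+2) = (j+2-alpha) p_(j+1)] makes the generating function of the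
   steps solve a first order linear differential equation along each radius;
   solving it and letting the radius tend to [1] (Abel) yields [c] in closed
   form, from which the asymptotics are read off.
   Convergence of characteristic functions is turned into convergence in
   distribution by smoothing: the convolution of a law with a centred Gaussian
   has a density which is the Fourier integral of the characteristic function
   against a Gaussian weight, so that dominated convergence applies. *)
Require Import Defs.
From mathcomp Require Import all_boot all_order all_algebra finmap.
From mathcomp Require Import all_classical all_reals all_analysis.
From mathcomp Require Import measurable_realfun zify ring lra.

Set Implicit Arguments.
Unset Strict Implicit.
Unset Printing Implicit Defensive.

Import Order.TTheory GRing.Theory Num.Theory.
Import numFieldNormedType.Exports.

Local Open Scope classical_set_scope.
Local Open Scope ring_scope.

(** * Gaussian kernels *)

(** Complex quantities are carried as pairs of reals. A free phase [th] in [cos (k * x + th)] takes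
    the place of the complex exponential: adding an independent step only changes the phase. The
    value [p 0] is fixed by normalisation and does not fit the recurrence, so the generating
    function starts at [p 1]. With the index shifted by one and z = exp(i s), F(r) = sum over j >= 2
    of p_(j-1) z^j r^j satisfies (1 - r z) F' + alpha z F = 2 p_1 z^2 r. The solutions are built
    from (1 - r z)^alpha, or from (1 - r z) log(1 - r z) when alpha = 1. At r = 1 the modulus |1 -
    z| = 2 sin(s/2) ~ s produces the power s^alpha, and the argument of 1 - z, which tends to -pi/2,
    produces the factor cos(alpha pi/2) that the normalisation of the steps divides out. The
    constants cancel against [1 - p 0]. The limit law is given only by the Fourier integral that
    defines its density. Fubini moves that integral onto the Gaussian, so both laws get the same
    smoothed formula. *)

Lemma dominated_Rintegral_cvg d (T : measurableType d) (R : realType)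
    (mu : {measure set T -> \bar R}) (D : set T) (f_ : nat -> T -> R)
    (f g : T -> R) :
  measurable D -> (forall n, measurable_fun D (f_ n)) ->
  (forall x, D x -> f_ n x @[n --> \oo] --> f x) ->
  mu.-integrable D (EFin \o g) ->
  (forall n x, D x -> `|f_ n x| <= g x) ->
  mu.-integrable D (EFin \o f) /\
  \int[mu]_(x in D) f_ n x @[n --> \oo] --> \int[mu]_(x in D) f x.
Proof.
move=> mD mf_ f_f ig f_g.
have mf : measurable_fun D f by exact: measurable_fun_cvg f_f.
have [|||||fi _ c] := @dominated_convergence _ _ _ mu D mD
  (fun n x => (f_ n x)%:E) (EFin \o f) (EFin \o g).
- by move=> n; exact/measurable_EFinP.
- exact/measurable_EFinP.
- by apply/aeW => x Dx; apply: cvg_EFin; [exact: nearW|exact: f_f].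
- exact: ig.
- by apply/aeW => x n Dx; rewrite lee_fin f_g.
split => //; rewrite /Rintegral; apply: fine_cvg.
by rewrite fineK//; exact: integrable_fin_num.
Qed.

Lemma integrable_le d (T : measurableType d) (R : realType)
    (mu : {measure set T -> \bar R}) (D : set T) (f g : T -> R) :
  measurable D -> measurable_fun D f -> mu.-integrable D (EFin \o g) ->
  (forall x, D x -> `|f x| <= g x) -> mu.-integrable D (EFin \o f).
Proof.
move=> mD mf ig fg; apply: le_integrable ig => //; first exact/measurable_EFinP.
by move=> x Dx /=; rewrite lee_fin (le_trans (fg _ Dx))// ler_norm.
Qed.

(** The integral over [-n, n] is [f n - f (- n)], and [|f'|] dominates the truncations. This serves
    as integration by parts on the whole line. *)
Lemma Rintegral_derive_eq0 (R : realType) (f f' : R -> R) :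
  (forall x : R, is_derive x 1 f (f' x)) -> continuous f' ->
  lebesgue_measure.-integrable setT (EFin \o f') ->
  f n%:R @[n --> \oo] --> 0 -> f (- n%:R) @[n --> \oo] --> 0 ->
  \int[lebesgue_measure]_x f' x = 0.
Proof.
move=> df cf' if' fy fNy.
have cf x : {for x, continuous f}.
  by apply/differentiable_continuous/derivable1_diffP.
have mf' : measurable_fun setT f' by exact: continuous_measurable_fun.
pose D n : set R := `[- n%:R, n%:R]%classic.
have [||||_] := @dominated_Rintegral_cvg _ _ _ lebesgue_measure setT
  (fun n => f' \_ (D n)) f' (fun x => `|f' x|) measurableT.
- by move=> n; apply/(measurable_restrictT _ (measurable_itv _))/measurable_funTS.
- move=> x _; apply: cvg_near_cst; near=> n; rewrite /= patchE ifT//.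
  rewrite inE /D /= in_itv/= -ler_norml.
  by near: n; exact: nbhs_infty_ger.
- exact: integrable_norm.
- by move=> n x _; rewrite /= patchE; case: ifPn => // _; rewrite normr0.
move=> /cvg_lim => <-//.
have fyB : f n%:R - f (- n%:R) @[n --> \oo] --> (0 : R).
  by rewrite -[X in _ --> X](subr0 0); exact: cvgB.
apply/cvg_lim => //; apply: cvg_trans fyB; apply: near_eq_cvg; near=> n.
have n0 : (0 < n)%N by near: n; exact: nbhs_infty_gt.
rewrite -Rintegral_mkcond /Rintegral.
rewrite (@continuous_FTC2 _ _ f)//.
- by rewrite gtrN ?ltr0n.
- exact/continuous_subspaceT.
- split.
  + by move=> x _; exact: ex_derive.
  + by apply: cvg_at_right_filter; exact: cf.
  + by apply: cvg_at_left_filter; exact: cf.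
- by move=> x _; rewrite derive1E; exact: derive_val.
Unshelve. all: by end_near. Qed.

Lemma is_derive_normal_pdf (R : realType) (m s x : R) : 0 < s ->
  is_derive x 1 (normal_pdf m s) (- ((x - m) / s ^+ 2) * normal_pdf m s x).
Proof.
move=> s0; rewrite normal_pdfE ?gt_eqF//.
pose g (y : R) := - (y - m) ^+ 2 / (s ^+ 2 *+ 2).
have dg : is_derive x 1 g (- ((x - m) / s ^+ 2)).
  apply: is_derive_eq; rewrite /GRing.scale/=.
  by field; rewrite gt_eqF.
rewrite /normal_fun.
apply: (@is_derive_eq _ _ _ (fun y => normal_peak s * expR (g y))).
rewrite /GRing.scale/= /g; ring.
Qed.

(** Half of the exponent is kept as a density of variance 2 s^2; the other half is a free factor
    that can absorb a polynomial or give a tail bound. The ratio of the two peaks is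
    [Num.sqrt 2]. *)
Lemma normal_pdf_split (R : realType) (m s x : R) : 0 < s ->
  normal_pdf m s x = Num.sqrt 2 * expR (- (x - m) ^+ 2 / (s ^+ 2 *+ 4)) *
    normal_pdf m (Num.sqrt 2 * s) x.
Proof.
move=> s0; have s20 : 0 < Num.sqrt 2 :> R by rewrite sqrtr_gt0.
rewrite !normal_pdfE ?gt_eqF ?mulr_gt0// /normal_fun /normal_peak.
rewrite [RHS]mulrACA -expRD !exprMn sqr_sqrtr//; congr (_ * expR _).
  rewrite (_ : 2 * s ^+ 2 * pi *+ 2 = 2 * (s ^+ 2 * pi *+ 2)); last by ring.
  rewrite sqrtrM// invfM mulrA mulfV ?mul1r ?gt_eqF//.
by field; rewrite gt_eqF.
Qed.

Lemma centered_normal_pdf_le (R : realType) (m s x : R) : 0 < s ->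
  `|x - m| * normal_pdf m s x <=
  s * Num.sqrt 2 * normal_pdf m (Num.sqrt 2 * s) x.
Proof.
move=> s0.
rewrite normal_pdf_split// !mulrA ler_wpM2r ?normal_pdf_ge0//.
rewrite -mulrAC ler_wpM2r//.
have := expR_ge1Dx ((x - m) ^+ 2 / (s ^+ 2 *+ 4)).
rewrite mulNr expRN ler_pdivrMr ?expR_gt0// => h.
apply: le_trans (ler_wpM2l (ltW s0) h).
(* With y = (x - m)^2 / (4 s^2) and exp y >= 1 + y, what remains is |x - m| <= s (1 + y), whose
   defect is a perfect square. *)
rewrite -subr_ge0 (_ : _ - _ = s * (1 - `|x - m| / (s *+ 2)) ^+ 2).
  by rewrite mulr_ge0 ?sqr_ge0 ?ltW.
by rewrite -[(x - m) ^+ 2]real_normK ?num_real//; field; rewrite gt_eqF.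
Qed.

Lemma integrable_centered_normal_pdf (R : realType) (m s : R) : 0 < s ->
  lebesgue_measure.-integrable setT
    (EFin \o (fun x : R => `|x - m| * normal_pdf m s x)).
Proof.
move=> s0.
apply: (@integrable_le _ _ R lebesgue_measure setT _ (fun x : R =>
  (s * Num.sqrt 2) *
   normal_pdf m (Num.sqrt 2 * s) x)) => //.
- apply: measurable_funM; last exact: measurable_normal_pdf.
  by apply: measurableT_comp => //; exact: measurable_funB.
- rewrite (_ : _ \o _ = fun x : R => ((s * Num.sqrt 2)%:E *
    (normal_pdf m (Num.sqrt 2 * s) x)%:E)%E)//.
  by apply: integrableZl => //; exact: integrable_normal_pdf.
- move=> x _; rewrite ger0_norm ?mulr_ge0 ?normal_pdf_ge0//.
  exact: centered_normal_pdf_le.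
Qed.

Lemma integrable_normal_pdfM (R : realType) (m s : R) (f : R -> R) :
  measurable_fun setT f -> (forall x, `|f x| <= 1) ->
  lebesgue_measure.-integrable setT
    (EFin \o (fun x : R => normal_pdf m s x * f x)).
Proof.
move=> mf f1; apply: (@integrable_le _ _ R lebesgue_measure setT _
  (normal_pdf m s)) => //.
- by apply: measurable_funM => //; exact: measurable_normal_pdf.
- exact: integrable_normal_pdf.
- move=> x _; rewrite normrM ger0_norm ?normal_pdf_ge0//.
  by rewrite ler_piMr ?normal_pdf_ge0.
Qed.

Lemma normr_cos_le1 (R : realType) (x : R) : `|cos x| <= 1.
Proof. by rewrite ler_norml cos_geN1 cos_le1. Qed.

Lemma normr_sin_le1 (R : realType) (x : R) : `|sin x| <= 1.
Proof. by rewrite ler_norml sin_geN1 sin_le1. Qed.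

Lemma continuous_sin_affine (R : realType) (a b c : R) :
  continuous (fun x : R => sin (a * (x - b) + c)).
Proof.
move=> x; apply: (@continuous_comp _ _ _ (fun x =>
  a * (x - b) + c) (@sin R)); last exact: continuous_sin.
by apply: cvgD; [apply: cvgM; [exact: cvg_cst|apply: cvgB;
  [exact: cvg_id|exact: cvg_cst]]|exact: cvg_cst].
Qed.

Lemma continuous_cos_affine (R : realType) (a b c : R) :
  continuous (fun x : R => cos (a * (x - b) + c)).
Proof.
move=> x; apply: (@continuous_comp _ _ _ (fun x =>
  a * (x - b) + c) (@cos R)); last exact: continuous_cos.
by apply: cvgD; [apply: cvgM; [exact: cvg_cst|apply: cvgB;
  [exact: cvg_id|exact: cvg_cst]]|exact: cvg_cst].
Qed.

Lemma cvg_normal_pdf (R : realType) (m s : R) (u : nat -> R) : 0 < s ->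
  `|u n - m| @[n --> \oo] --> +oo -> normal_pdf m s (u n) @[n --> \oo] --> 0.
Proof.
move=> s0 uoo.
have s20 : Num.sqrt 2 * s != 0 by rewrite gt_eqF// mulr_gt0// sqrtr_gt0.
pose C := s * Num.sqrt 2 * normal_peak (Num.sqrt 2 * s).
have Coo : C * `|u n - m|^-1 @[n --> \oo] --> 0.
  rewrite -[X in _ --> X](mulr0 C); apply: cvgM; first exact: cvg_cst.
  apply/gtr0_cvgV0 => //; near=> n.
  by near: n; exact: (cvgry_gt uoo 0).
apply: (squeeze_cvgr _ (cvg_cst 0) Coo); near=> n.
rewrite normal_pdf_ge0/= ler_pdivlMr; last by near: n; exact: (cvgry_gt uoo 0).
rewrite mulrC (le_trans (centered_normal_pdf_le _ _ s0))// ler_wpM2l//.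
  by rewrite mulr_ge0// ltW.
exact: normal_pdf_ub.
Unshelve. all: by end_near. Qed.

Lemma integrable_EFinZl d (T : measurableType d) (R : realType)
    (mu : {measure set T -> \bar R}) (D : set T) (f : T -> R) (k : R) :
  measurable D -> mu.-integrable D (EFin \o f) ->
  mu.-integrable D (EFin \o (fun x => k * f x)).
Proof. by move=> mD fi; exact: (integrableZl mD k fi). Qed.

Lemma integrable_EFinD d (T : measurableType d) (R : realType)
    (mu : {measure set T -> \bar R}) (D : set T) (f g : T -> R) :
  measurable D -> mu.-integrable D (EFin \o f) ->
  mu.-integrable D (EFin \o g) ->
  mu.-integrable D (EFin \o (fun x => f x + g x)).
Proof. by move=> mD fi gi; exact: (integrableD mD fi gi). Qed.

(** As a function of the frequency v, the integral G satisfies G' = - s^2 v G: differentiate under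
    the integral, then integrate by parts. Hence G(v) exp(s^2 v^2 / 2) is constant, with value cos
    th at v = 0. *)
Lemma Rintegral_normal_cos (R : realType) (m s u th : R) : 0 < s ->
  \int[lebesgue_measure]_x (normal_pdf m s x * cos (u * (x - m) + th)) =
  cos th * expR (- (s * u) ^+ 2 / 2).
Proof.
move=> s0.
pose mu := @lebesgue_measure R.
pose n := normal_pdf m s.
have cn : continuous n by apply: continuous_normal_pdf; rewrite gt_eqF.
have mc a : measurable_fun setT (fun x : R => cos (a * (x - m) + th)).
  by apply: continuous_measurable_fun; exact: continuous_cos_affine.
have ms a : measurable_fun setT (fun x : R => sin (a * (x - m) + th)).
  by apply: continuous_measurable_fun; exact: continuous_sin_affine.
have intc a : mu.-integrable setT (EFin \o (fun x : R =>
  n x * cos (a * (x - m) + th))).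
  by apply: integrable_normal_pdfM => // x; exact: normr_cos_le1.
have ints a : mu.-integrable setT
    (EFin \o (fun x : R => (x - m) * n x * sin (a * (x - m) + th))).
  apply: (@integrable_le _ _ R mu setT _ (fun x : R => `|x - m| * n x)) => //.
  - apply: measurable_funM; last exact: ms.
    apply: measurable_funM; first exact: measurable_funB.
    exact: measurable_normal_pdf.
  - exact: integrable_centered_normal_pdf.
  - move=> x _; rewrite normrM normrM (@ger0_norm _ (n x)) ?normal_pdf_ge0//.
    by rewrite ler_piMr ?normr_sin_le1 ?mulr_ge0 ?normal_pdf_ge0.
have byparts a : \int[mu]_x ((x - m) * n x * sin (a * (x - m) + th)) =
    s ^+ 2 * a * \int[mu]_x (n x * cos (a * (x - m) + th)).
  pose f x := n x * sin (a * (x - m) + th).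
  have f0 (w : nat -> R) : `|w k - m| @[k --> \oo] --> +oo ->
      f (w k) @[k --> \oo] --> 0.
    move=> /(cvg_normal_pdf s0) n0; apply: norm_cvg0.
    apply: (squeeze_cvgr _ (cvg_cst 0) n0); near=> k.
    rewrite normr_ge0/= normrM ger0_norm ?normal_pdf_ge0//.
    by rewrite ler_piMr ?normal_pdf_ge0 ?normr_sin_le1.
  (* This is the derivative of [f], because n' = - (x - m) / s^2 * n; its vanishing integral is the
     integration by parts. *)
  pose f' x := - (s ^+ 2)^-1 * ((x - m) * n x * sin (a * (x - m) + th)) +
    a * (n x * cos (a * (x - m) + th)).
  have : \int[mu]_x f' x = 0.
    apply: (@Rintegral_derive_eq0 R f f').
    - move=> x; have dn := @is_derive_normal_pdf _ m s x s0.
      rewrite /f /f' /n; apply: is_derive_eq; rewrite /GRing.scale/=.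
      by field; rewrite gt_eqF.
    - move=> x; apply: cvgD.
        apply: cvgM; first exact: cvg_cst.
        apply: cvgM; last exact: continuous_sin_affine.
        by apply: cvgM; [apply: cvgB; [exact: cvg_id|exact: cvg_cst]|exact: cn].
      apply: cvgM; first exact: cvg_cst.
      by apply: cvgM; [exact: cn|exact: continuous_cos_affine].
    - by apply: integrable_EFinD => //; exact: integrable_EFinZl.
    - apply: f0; apply: (ger_cvgy _ (cvg_comp _ _ cvgr_idn (cvg_addrr (- `|m|)))).
      by apply: nearW => k; rewrite /= (le_trans _ (lerB_dist _ _))// normr_nat.
    - apply: f0; apply: (ger_cvgy _ (cvg_comp _ _ cvgr_idn (cvg_addrr (- `|m|)))).
      by apply: nearW => k; rewrite /= (le_trans _
        (lerB_dist _ _))// normrN normr_nat.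
  rewrite RintegralD//; last 2 first.
  - exact: integrable_EFinZl.
  - exact: integrable_EFinZl.
  rewrite RintegralZl// RintegralZl//.
  set I1 := Rintegral _ _ _; set I2 := Rintegral _ _ _ => h.
  rewrite (_ : s ^+ 2 * a * I2 = I1 + s ^+ 2 * (- (s ^+ 2)^-1 * I1 + a * I2)).
    by rewrite h mulr0 addr0.
  by field; rewrite gt_eqF.
pose G v := \int[mu]_x (n x * cos (v * (x - m) + th)).
have dG (v : R) : is_derive v 1 G (- (s ^+ 2) * v * G v).
  have d1 (w y : R) : is_derive w 1 (fun w => n y * cos (w * (y - m) + th))
      (- ((y - m) * n y * sin (w * (y - m) + th))).
    apply: is_derive_eq; rewrite /GRing.scale/=; ring.
  (* The bound [ub] does not depend on the frequency, so the radius 1 of the neighbourhood is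
     arbitrary. *)
  have I : `]v - 1, v + 1[%classic v by rewrite /= in_itv/= ltrBlDr ltrDl ltr01.
  have p (x y : R) : partial1of2 (fun w y =>
    n y * cos (w * (y - m) + th)) x y =
      - ((y - m) * n y * sin (x * (y - m) + th)).
    by rewrite partial1of2E; exact: derive_val.
  have ub (x y : R) : `]v - 1, v + 1[%classic x -> setT y ->
      `|partial1of2 (fun w y => n y * cos (w * (y - m) + th)) x y| <=
      `|y - m| * n y.
    move=> _ _; rewrite p normrN normrM normrM (@ger0_norm _
      (n y)) ?normal_pdf_ge0//.
    by rewrite ler_piMr ?normr_sin_le1 ?mulr_ge0 ?normal_pdf_ge0.
  apply: DeriveDef.
    apply: (derivable_under_integral measurableT I _ _ _
      (integrable_centered_normal_pdf m s0) ub) => //.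
    by move=> y; rewrite mulr_ge0 ?normal_pdf_ge0.
  rewrite -derive1E (differentiation_under_integral measurableT I _ _ _
    (integrable_centered_normal_pdf m s0) ub) => //.
  - rewrite !mulNr /G -byparts -mulN1r -RintegralZl//.
    by apply: eq_Rintegral => y _; rewrite p mulN1r.
  - by move=> y; rewrite mulr_ge0 ?normal_pdf_ge0.
pose E v := G v * expR ((s * v) ^+ 2 / 2).
have dE (v : R) : is_derive v 1 E 0.
  have dGv := dG v; apply: is_derive_eq; rewrite /GRing.scale/=.
  by field.
have := is_derive_0_is_cst u 0 dE.
rewrite /E mulr0 expr0n/= mul0r expR0 mulr1 /G.
under [X in _ = X]eq_Rintegral do rewrite mul0r add0r.
rewrite RintegralZr//; last exact: integrable_normal_pdf.
rewrite [X in _ = X * _]/Rintegral integral_normal_pdf/= mul1r => <-.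
by rewrite -mulrA -expRD mulNr addrN expR0 mulr1.
Unshelve. all: by end_near. Qed.

(** * Gaussian smoothing and convergence in distribution *)

Lemma measurable_dist_ge (R : realType) (m eta : R) :
  measurable [set x : R | eta <= `|x - m|].
Proof.
rewrite (_ : mkset _ = (fun x : R => `|x - m|) @^-1` `[eta, +oo[%classic).
  have : measurable_fun setT (fun x : R => `|x - m|).
    by apply: measurableT_comp => //; exact: measurable_funB.
  by move=> /(_ measurableT _ (measurable_itv `[eta, +oo[)); rewrite setTI.
by apply/seteqP; split => x /=; rewrite in_itv/= andbT.
Qed.

(** On the tail the free factor of [normal_pdf_split] is at most exp(- eta^2 / (4 s^2)), and the
    remaining density has mass at most 1. *)
Lemma normal_prob_tail (R : realType) (m s eta : R) : 0 < s -> 0 <= eta ->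
  (normal_prob m s [set x : R | (eta <= `|x - m|)%R] <=
   (Num.sqrt 2 * expR (- eta ^+ 2 / (s ^+ 2 *+ 4)))%:E)%E.
Proof.
move=> s0 eta0; set K := Num.sqrt 2 * _.
have K0 : 0 <= K by rewrite mulr_ge0 ?expR_ge0.
set A := [set _ | _]; have mA : measurable A by exact: measurable_dist_ge.
have mN (s' : R) (B : set R) : measurable_fun B (fun x => (normal_pdf m s' x)%:E).
  by apply/measurable_EFinP/measurable_funTS; exact: measurable_normal_pdf.
apply: (@le_trans _ _ (\int[lebesgue_measure]_(x in A)
   (K%:E * (normal_pdf m (Num.sqrt 2 * s) x)%:E))%E).
  apply: ge0_le_integral => //.
  - by move=> x _; rewrite lee_fin normal_pdf_ge0.
  - exact: mN.
  - by apply: measurable_funeM; exact: mN.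
  - move=> x /= Ax; rewrite -EFinM lee_fin normal_pdf_split//.
    rewrite ler_wpM2r ?normal_pdf_ge0// ler_wpM2l// ler_expR.
    rewrite !mulNr lerN2 ler_wpM2r ?invr_ge0 ?mulrn_wge0 ?sqr_ge0//.
    by rewrite -[leRHS]real_normK ?num_real// lerXn2r ?nnegrE.
rewrite ge0_integralZl//; last 2 first.
- exact: mN.
- by move=> x _; rewrite lee_fin normal_pdf_ge0.
rewrite -[leRHS]mule1 lee_wpmul2l//.
exact: (@probability_le1 _ _ _ (normal_prob m (Num.sqrt 2 * s))).
Qed.

(** A product bound makes the iterated integral factor. The exchanges of integrals below rest on
    bounds of this shape. *)
Lemma integrable_prod_le d1 d2 (T1 : measurableType d1) (T2 : measurableType d2)
    (R : realType) (m1 : {sigma_finite_measure set T1 -> \bar R})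
    (m2 : {sigma_finite_measure set T2 -> \bar R})
    (f : T1 * T2 -> R) (a : T1 -> R) (b : T2 -> R) :
  measurable_fun setT f ->
  m1.-integrable setT (EFin \o a) -> m2.-integrable setT (EFin \o b) ->
  (forall x y, `|f (x, y)| <= a x * b y) ->
  (m1 \x m2)%E.-integrable setT (EFin \o f).
Proof.
move=> mf ia ib fab.
have mf' : measurable_fun setT (EFin \o f) by exact/measurable_EFinP.
apply/integrable12ltyP => //=.
have /integrableP[ma loa] := ia; have /integrableP[mb lob] := ib.
have mabsf : measurable_fun setT (abse \o (EFin \o f)).
  exact: measurableT_comp.
apply: (@le_lt_trans _ _ (\int[m1]_x
   (`|(a x)%:E| * \int[m2]_y `|(b y)%:E|))%E).
  apply: ge0_le_integral => //.
  - by move=> x _; exact: integral_ge0.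
  - by apply: (measurable_fun_fubini_tonelli_F (abse \o (EFin \o f))) => //=.
  - apply: emeasurable_funM => //.
    exact: measurableT_comp.
  - move=> x _; rewrite -ge0_integralZl//; last exact: measurableT_comp.
    apply: ge0_le_integral => //.
    + exact: (measurableT_comp mabsf).
    + by apply: measurable_funeM; exact: measurableT_comp.
    + move=> y _ /=; rewrite -EFinM lee_fin -normrM (le_trans (fab x y))//.
      exact: ler_norm.
rewrite ge0_integralZr//; last exact: integral_ge0.
  by rewrite lte_mul_pinfty// ?integral_ge0// ge0_fin_numE// integral_ge0.
exact: measurableT_comp.
Qed.

Lemma Rintegral_swap d1 d2 (T1 : measurableType d1) (T2 : measurableType d2)
    (R : realType) (m1 : {sigma_finite_measure set T1 -> \bar R})
    (m2 : {sigma_finite_measure set T2 -> \bar R})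
    (f : T1 * T2 -> R) (a : T1 -> R) (b : T2 -> R) :
  measurable_fun setT f ->
  m1.-integrable setT (EFin \o a) -> m2.-integrable setT (EFin \o b) ->
  (forall x y, `|f (x, y)| <= a x * b y) ->
  \int[m1]_x \int[m2]_y f (x, y) = \int[m2]_y \int[m1]_x f (x, y).
Proof.
move=> mf ia ib fab; have i12 := integrable_prod_le mf ia ib fab.
have i2 x : m2.-integrable setT (EFin \o (fun y => f (x, y))).
  apply: (@integrable_le _ _ R m2 setT _ (fun y => a x * b y)) => //.
    exact: (measurableT_comp mf).
  exact: integrable_EFinZl.
have i1 y : m1.-integrable setT (EFin \o (fun x => f (x, y))).
  apply: (@integrable_le _ _ R m1 setT _ (fun x => b y * a x)) => //.
  - exact: (measurableT_comp mf).
  - exact: integrable_EFinZl.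
  - by move=> x _; rewrite mulrC.
have := Fubini i12 => /=.
rewrite /Rintegral => F.
under eq_integral => x _ do rewrite fineK ?(integrable_fin_num measurableT
  (i2 x))//.
under [X in _ = fine X]eq_integral =>
  y _ do rewrite fineK ?(integrable_fin_num measurableT (i1 y))//.
by rewrite F.
Qed.

Lemma measurable_Rintegral_snd d1 d2 (T1 : measurableType d1)
  (T2 : measurableType d2)
    (R : realType) (m1 : {sigma_finite_measure set T1 -> \bar R})
    (m2 : {sigma_finite_measure set T2 -> \bar R})
    (f : T1 * T2 -> R) (a : T1 -> R) (b : T2 -> R) :
  measurable_fun setT f ->
  m1.-integrable setT (EFin \o a) -> m2.-integrable setT (EFin \o b) ->
  (forall x y, `|f (x, y)| <= a x * b y) ->
  measurable_fun setT (fun y => \int[m1]_x f (x, y)).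
Proof.
move=> mf ia ib fab; have i12 := integrable_prod_le mf ia ib fab.
have := measurable_fubini_G i12.
by move=> h; exact: (measurableT_comp (fine_measurable measurableT)).
Qed.

Lemma normal_pdf_sym (R : realType) (x y s : R) :
  0 < s -> normal_pdf x s y = normal_pdf y s x.
Proof.
by move=> s0; rewrite !normal_pdfE ?gt_eqF// /normal_fun -sqrrN opprB.
Qed.

(** The unnormalised Gaussian of width [s] is the characteristic function of the normal law of width
    [s^-1]. *)
Lemma normal_fun_fourier (R : realType) (y s x : R) : 0 < s ->
  normal_fun y s x =
  \int[lebesgue_measure]_k (normal_pdf 0 s^-1 k * cos (k * (x - y))).
Proof.
move=> s0.
have := @Rintegral_normal_cos R 0 s^-1 (x - y) 0 _; rewrite invr_gt0 => /(_ s0).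
rewrite cos0 mul1r => h.
rewrite (_ : normal_fun _ _ _ = expR (- (s^-1 * (x - y)) ^+ 2 / 2)).
  rewrite -h; apply: eq_Rintegral => k _.
  by rewrite subr0 addr0 (mulrC (x - y)).
by rewrite /normal_fun; congr expR; field; rewrite gt_eqF.
Qed.

Lemma measurable_cosM (R : realType) (y : R) :
  measurable_fun setT (fun p : R * R => cos (p.2 * (p.1 - y))).
Proof.
apply: (measurableT_comp (continuous_measurable_fun (@continuous_cos R))).
by apply: measurable_funM => //; exact: measurable_funB.
Qed.

(** The left side is the density at [y] of [nu] convolved with a centred Gaussian; the right side
    sees [nu] only through the real part of its characteristic function, rotated by the phase - k
    y. *)
Lemma Rintegral_normal_pdf_cos (R : realType) (nu : probability R R) (y s : R) :
  0 < s ->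
  \int[nu]_x normal_pdf y s x = normal_peak s *
    \int[lebesgue_measure]_k
      (normal_pdf 0 s^-1 k * \int[nu]_x cos (k * (x - y))).
Proof.
move=> s0; have s'0 : 0 < s^-1 by rewrite invr_gt0.
under eq_Rintegral do rewrite normal_pdfE ?gt_eqF//.
have mc k : measurable_fun setT (fun x : R => cos (k * (x - y))).
  apply: (measurableT_comp (continuous_measurable_fun (@continuous_cos R))).
  by apply: measurable_funM => //; exact: measurable_funB.
have i1 : nu.-integrable setT (EFin \o (fun=> 1)).
  exact: finite_measure_integrable_cst.
have ic k : nu.-integrable setT (EFin \o (fun x => cos (k * (x - y)))).
  apply: (@integrable_le _ _ R nu setT _ (fun=> 1)) => //.
  by move=> x _; exact: normr_cos_le1.
have mf : measurable_fun setT (fun p : R * R =>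
  normal_pdf 0 s^-1 p.2 * cos (p.2 * (p.1 - y))).
  apply: measurable_funM; last exact: measurable_cosM.
  by apply: measurableT_comp => //; exact: measurable_normal_pdf.
have fab (x k : R) : `|normal_pdf 0 s^-1 k * cos (k * (x - y))| <=
  (fun=> 1) x * normal_pdf 0 s^-1 k.
  rewrite mul1r normrM ger0_norm ?normal_pdf_ge0//.
  by rewrite ler_piMr ?normal_pdf_ge0 ?normr_cos_le1.
rewrite RintegralZl//; last first.
  apply: (@integrable_le _ _ R nu setT _ (fun=> 1)) => //.
    exact: measurable_normal_fun.
  move=> x _; rewrite ger0_norm ?normal_fun_ge0// /normal_fun -[leRHS]expR0.
  by rewrite ler_expR mulNr oppr_le0 mulr_ge0 ?sqr_ge0 ?invr_ge0 ?mulrn_wge0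
    ?sqr_ge0.
congr (_ * _).
under eq_Rintegral do rewrite normal_fun_fourier//.
rewrite (@Rintegral_swap _ _ _ _ R nu lebesgue_measure _ _ _ mf i1
  (integrable_normal_pdf 0 s^-1) fab)/=.
by apply: eq_Rintegral => k _; rewrite RintegralZl.
Qed.

Lemma integrable_cst1 d (T : measurableType d) (R : realType)
    (nu : probability T R) : nu.-integrable setT (EFin \o (fun=> 1)).
Proof. exact: finite_measure_integrable_cst. Qed.

Lemma integrable_le1 d (T : measurableType d) (R : realType)
    (nu : probability T R) (f : T -> R) :
  measurable_fun setT f -> (forall x, `|f x| <= 1) ->
  nu.-integrable setT (EFin \o f).
Proof.
move=> mf f1; apply: (@integrable_le _ _ R nu setT _ (fun=> 1)) => //.
exact: integrable_cst1.
Qed.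

Lemma cvg_Rintegral_normal_pdf (R : realType) (nu_ : nat -> probability R R)
    (psi : R -> R -> R) (y s : R) :
  (forall k, \int[nu_ n]_x cos (k * (x - y)) @[n --> \oo] --> psi k y) ->
  0 < s ->
  \int[nu_ n]_x normal_pdf y s x @[n --> \oo] -->
  normal_peak s * \int[lebesgue_measure]_k (normal_pdf 0 s^-1 k * psi k y).
Proof.
move=> hpsi s0.
have mc k : measurable_fun setT (fun x : R => cos (k * (x - y))).
  apply: (measurableT_comp (continuous_measurable_fun (@continuous_cos R))).
  by apply: measurable_funM => //; exact: measurable_funB.
under eq_fun do rewrite Rintegral_normal_pdf_cos//.
apply: cvgM; first exact: cvg_cst.
have [||||_] // := @dominated_Rintegral_cvg _ _ R lebesgue_measure setT
  (fun n k => normal_pdf 0 s^-1 k * \int[nu_ n]_x cos (k * (x - y)))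
  (fun k => normal_pdf 0 s^-1 k * psi k y) (normal_pdf 0 s^-1) measurableT.
- move=> n.
  have -> : (fun k => normal_pdf 0 s^-1 k * \int[nu_ n]_x cos (k * (x - y))) =
     (fun k => \int[nu_ n]_x (normal_pdf 0 s^-1 k * cos (k * (x - y)))).
    apply/funext => k; rewrite RintegralZl//.
    by apply: integrable_le1 => // x; exact: normr_cos_le1.
  apply: (@measurable_Rintegral_snd _ _ _ _ R (nu_ n) lebesgue_measure
    (fun p : R * R => normal_pdf 0 s^-1 p.2 * cos (p.2 * (p.1 - y))) _ _ _
    (integrable_cst1 (nu_ n)) (integrable_normal_pdf 0 s^-1)).
    apply: measurable_funM; last exact: measurable_cosM.
    by apply: measurableT_comp => //; exact: measurable_normal_pdf.
  move=> x k /=; rewrite mul1r normrM ger0_norm ?normal_pdf_ge0//.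
  by rewrite ler_piMr ?normal_pdf_ge0 ?normr_cos_le1.
- by move=> k _; apply: cvgM; [exact: cvg_cst|exact: hpsi].
- exact: integrable_normal_pdf.
- move=> n k _; rewrite normrM ger0_norm ?normal_pdf_ge0//.
  rewrite ler_piMr ?normal_pdf_ge0//.
  have ic : (nu_ n).-integrable setT (EFin \o (fun x => cos (k * (x - y)))).
    by apply: integrable_le1 => // x; exact: normr_cos_le1.
  rewrite (le_trans (le_normr_Rintegral _ ic))//.
  rewrite (@le_trans _ _ (\int[nu_ n]_x 1))//.
    apply: le_Rintegral => //.
    - exact: integrable_norm.
    - exact: integrable_cst1.
    - by move=> x _; exact: normr_cos_le1.
  by rewrite Rintegral_cst//= mul1r -[leRHS]/(fine 1%E) fine_le
    ?fin_num_measure ?probability_le1.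
Qed.

Lemma measurable_normal_pdf2 (R : realType) (s : R) : 0 < s ->
  measurable_fun setT (fun p : R * R => normal_pdf p.1 s p.2).
Proof.
move=> s0; under eq_fun do rewrite normal_pdfE ?gt_eqF//.
apply: measurable_funM => //; apply: measurableT_comp => //.
apply: measurable_funM => //; apply: measurable_funN.
by apply: measurable_funX; exact: measurable_funB.
Qed.

(** As a function of its mean x, [normal_prob x s] of an interval is the smoothed indicator of that
    interval. So the smoothed probability is the integral of the smoothed density, by Fubini and the
    symmetry of [normal_pdf] in mean and argument. *)
Lemma Rintegral_normal_prob (R : realType) (nu : probability R R) (a b s : R) :
  0 < s ->
  \int[nu]_x fine (normal_prob x s `[a, b]) =
  \int[lebesgue_measure]_(y in `[a, b]) \int[nu]_x normal_pdf y s x.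
Proof.
move=> s0.
pose f (p : R * R) := \1_`[a, b] p.2 * normal_pdf p.1 s p.2.
have mf : measurable_fun setT f.
  apply: measurable_funM; last exact: measurable_normal_pdf2.
  by apply: measurableT_comp => //; exact: measurable_indic.
have iab : lebesgue_measure.-integrable setT
    (EFin \o (fun y : R => normal_peak s * \1_`[a, b] y)).
  apply: integrable_EFinZl => //.
  exact: integrable_indic_itv.
have fab (x y : R) : `|f (x, y)| <= (fun=> 1) x * (normal_peak s * \1_`[a, b] y).
  rewrite mul1r /f/= normrM ger0_norm// ger0_norm ?normal_pdf_ge0//.
  by rewrite mulrC ler_wpM2r// normal_pdf_ub ?gt_eqF.
have := @Rintegral_swap _ _ _ _ R nu lebesgue_measure _ _ _ mf
  (integrable_cst1 nu) iab fab.
rewrite /f/= => sw.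
rewrite [RHS]Rintegral_mkcond.
transitivity (\int[nu]_x \int[lebesgue_measure]_y (\1_`[a, b] y *
  normal_pdf x s y)).
  apply: eq_Rintegral => x _; rewrite /normal_prob -/(Rintegral _ _ _).
  rewrite Rintegral_mkcond; apply: eq_Rintegral => y _.
  by rewrite patchE [\1_`[a, b] y]indicE; case: (y \in _); rewrite ?mul1r ?mul0r.
rewrite sw; apply: eq_Rintegral => y _; rewrite patchE indicE.
case: (y \in _).
  by apply: eq_Rintegral => x _; rewrite mul1r normal_pdf_sym.
by under eq_Rintegral do rewrite mul0r; rewrite Rintegral_cst// mul0r.
Qed.

(** All smoothed densities are bounded by [normal_peak s], a constant, which is integrable on the
    bounded interval. *)
Lemma cvg_Rintegral_normal_prob (R : realType) (nu_ : nat -> probability R R)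
    (nu : probability R R) (a b s : R) : 0 < s ->
  (forall y, \int[nu_ n]_x normal_pdf y s x @[n --> \oo] -->
             \int[nu]_x normal_pdf y s x) ->
  \int[nu_ n]_x fine (normal_prob x s `[a, b]) @[n --> \oo] -->
  \int[nu]_x fine (normal_prob x s `[a, b]).
Proof.
move=> s0 cv; rewrite Rintegral_normal_prob//.
under eq_fun do rewrite Rintegral_normal_prob//.
have int_n (p : probability R R) y : p.-integrable setT (EFin \o normal_pdf y s).
  apply: (@integrable_le _ _ R p setT _ (fun=> normal_peak s * 1)) => //.
  - exact: measurable_normal_pdf.
  - by apply: integrable_EFinZl => //; exact: integrable_cst1.
  - by move=> x _; rewrite ger0_norm ?normal_pdf_ge0// mulr1 normal_pdf_ub
    ?gt_eqF.
have [||||_] // := @dominated_Rintegral_cvg _ _ R lebesgue_measure `[a, b]%classic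
  (fun n y => \int[nu_ n]_x normal_pdf y s x)
  (fun y => \int[nu]_x normal_pdf y s x) (fun=> normal_peak s) (measurable_itv _).
- move=> n; apply: measurable_funTS.
  apply: (measurableT_comp (fine_measurable measurableT)).
  apply: (measurable_fun_fubini_tonelli_G (fun p : R * R =>
    (normal_pdf p.2 s p.1)%:E));
    last by move=> ?; rewrite lee_fin normal_pdf_ge0.
  apply/measurable_EFinP; have := measurable_normal_pdf2 s0.
  by under [X in _ -> measurable_fun _ X]eq_fun do rewrite normal_pdf_sym//.
- apply: continuous_compact_integrable; first exact: segment_compact.
  by apply: continuous_subspaceT => x; exact: cvg_cst.
- move=> n y _; rewrite ger0_norm; last first.
    by apply: Rintegral_ge0 => x _; exact: normal_pdf_ge0.
  apply: (@le_trans _ _ (\int[nu_ n]_x (normal_peak s * 1))).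
    apply: le_Rintegral => //.
    - exact: int_n.
    - by apply: integrable_EFinZl => //; exact: integrable_cst1.
    - by move=> x _; rewrite mulr1 normal_pdf_ub ?gt_eqF.
  rewrite Rintegral_cst//= mulr1 ler_piMr ?normal_peak_ge0//.
  by rewrite -[leRHS]/(fine 1%E) fine_le ?fin_num_measure ?probability_le1.
Qed.

Lemma measurable_normal_prob_itv (R : realType) (a b s : R) : 0 < s ->
  measurable_fun setT (fun x : R => fine (normal_prob x s `[a, b])).
Proof.
move=> s0; apply: (measurableT_comp (fine_measurable measurableT)).
pose f (p : R * R) := (\1_`[a, b] p.2 * normal_pdf p.1 s p.2)%:E.
rewrite (_ : (fun x : R => _) = (fun x => \int[lebesgue_measure]_y f (x, y))%E).
  apply: (@measurable_fun_fubini_tonelli_F _ _ _ _ _ lebesgue_measure f);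
    last first.
    by move=> ?; rewrite lee_fin mulr_ge0 ?normal_pdf_ge0.
  apply/measurable_EFinP/measurable_funM; last exact: measurable_normal_pdf2.
  by apply: measurableT_comp => //; exact: measurable_indic.
apply/funext => x; rewrite /normal_prob integral_mkcond.
apply: eq_integral => y _; rewrite /f/= patchE [\1_`[a, b] y]indicE.
by case: (y \in _); rewrite ?mul1r ?mul0r.
Qed.

Lemma normal_prob_itv_ge (R : realType) (a b s eta x : R) :
  0 < s -> 0 <= eta -> a + eta <= x <= b - eta ->
  1 - Num.sqrt 2 * expR (- eta ^+ 2 / (s ^+ 2 *+ 4)) <=
  fine (normal_prob x s `[a, b]).
Proof.
move=> s0 eta0 /andP[ax xb]; rewrite -lee_fin EFinB fineK ?fin_num_measure//.
rewrite leeBlDr// -(@probability_setT _ _ _ (normal_prob x s)).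
have mA := measurable_dist_ge x eta.
apply: (@le_trans _ _ (normal_prob x s (`[a, b]%classic `|` [set y : R
  | eta <= `|y - x|]))).
  apply: le_measure; rewrite ?inE//; first exact: measurableU.
  move=> y _ /=; rewrite in_itv/=.
  have [h|h] := leP eta `|y - x|; [by right|left].
  by move: h; rewrite ltr_norml => /andP[h1 h2]; apply/andP; split; lra.
by apply: le_trans (measureU2 _ _ _) _ => //; rewrite leeD2l//;
  exact: normal_prob_tail.
Qed.

Lemma normal_prob_itv_le (R : realType) (a b s eta x : R) :
  0 < s -> 0 <= eta -> x <= a - eta \/ b + eta <= x ->
  fine (normal_prob x s `[a, b]) <=
  Num.sqrt 2 * expR (- eta ^+ 2 / (s ^+ 2 *+ 4)).
Proof.
move=> s0 eta0 h; rewrite -lee_fin fineK ?fin_num_measure//.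
apply: le_trans (normal_prob_tail x s0 eta0); apply: le_measure; rewrite ?inE//.
  exact: measurable_dist_ge.
move=> y /=; rewrite in_itv/= => /andP[ay yb].
case: h => h.
  by rewrite (le_trans _ (ler_norm _))//; lra.
by rewrite distrC (le_trans _ (ler_norm _))//; lra.
Qed.

Lemma le_fine_probability d (T : measurableType d) (R : realType)
    (p : probability T R) (A B : set T) : measurable A -> measurable B ->
  A `<=` B -> fine (p A) <= fine (p B).
Proof.
by move=> mA mB AB; rewrite fine_le ?fin_num_measure// le_measure ?inE.
Qed.

Lemma fine_probabilityU2 d (T : measurableType d) (R : realType)
    (p : probability T R) (A B C : set T) :
  measurable A -> measurable B -> measurable C -> A `<=` B `|` C ->
  fine (p A) <= fine (p B) + fine (p C).
Proof.
move=> mA mB mC ABC; rewrite -fineD ?fin_num_measure//.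
rewrite fine_le ?fin_numD ?fin_num_measure//.
apply: le_trans (measureU2 _ mB mC).
by apply: le_measure; rewrite ?inE//; exact: measurableU.
Qed.

Lemma fine_probability_le1 d (T : measurableType d) (R : realType)
    (p : probability T R) (A : set T) : measurable A -> fine (p A) <= 1.
Proof.
by move=> mA; rewrite -[leRHS]/(fine 1%E) fine_le ?fin_num_measure
  ?probability_le1.
Qed.

Lemma fine_probability_disjU d (T : measurableType d) (R : realType)
    (p : probability T R) (A B : set T) :
  measurable A -> measurable B -> A `&` B = set0 ->
  fine (p A) + fine (p B) <= 1.
Proof.
move=> mA mB AB; rewrite -fineD ?fin_num_measure// -measureU//.
by apply: fine_probability_le1; exact: measurableU.
Qed.

(** The indicator of [a - eta, b + eta], smoothed at a scale small against eta, is at least 1 - K on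
    [a, b] and at most K outside [a - 2 eta, b + 2 eta]. The error [e] is made of K on each side and
    e / 3 for the convergence. *)
Lemma near_le_probability_itv (R : realType) (nu_ : nat -> probability R R)
    (nu : probability R R) :
  (forall a b s, 0 < s ->
    \int[nu_ n]_x fine (normal_prob x s `[a, b]) @[n --> \oo] -->
    \int[nu]_x fine (normal_prob x s `[a, b])) ->
  forall a b eta e : R, 0 < eta -> 0 < e -> \forall n \near \oo,
    fine (nu `[a, b]%classic) - e <=
    fine (nu_ n `[a - 2 * eta, b + 2 * eta]%classic).
Proof.
move=> cv a b eta e eta0 e0.
(* Then eta^2 / (4 s^2) = 6 / e, and exp(- 6 / e) <= e / 6, so that K <= 2 * (e / 6) = e / 3. *)
pose s := eta * Num.sqrt (e / 24).
have e24 : 0 < e / 24 by rewrite divr_gt0.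
have s0 : 0 < s by rewrite mulr_gt0// sqrtr_gt0.
pose K := Num.sqrt 2 * expR (- eta ^+ 2 / (s ^+ 2 *+ 4)).
have K0 : 0 <= K by rewrite mulr_ge0 ?expR_ge0.
have Ke : K <= e / 3.
  have s2 : Num.sqrt 2 <= 2 :> R.
    rewrite -[leRHS]ger0_norm// -sqrtr_sqr ler_wsqrtr//.
    by rewrite -natrX ler_nat.
  rewrite (@le_trans _ _ (2 * (4 * (e / 24))))//; last by lra.
  apply: ler_pM => //.
  rewrite mulNr expRN -[leRHS]invrK lef_pV2 ?posrE ?expR_gt0 ?invr_gt0
    ?mulr_gt0//.
  apply: le_trans (expR_ge1Dx _).
  rewrite /s exprMn sqr_sqrtr ?ltW//.
  rewrite (_ : eta ^+ 2 / _ = (4 * (e / 24))^-1); last first.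
    by field; rewrite !gt_eqF.
  by rewrite ltrDr.
pose H x := fine (normal_prob x s `[a - eta, b + eta]).
have mH : measurable_fun setT H by exact: measurable_normal_prob_itv.
have H01 x : 0 <= H x <= 1.
  rewrite /H fine_ge0//=; exact: fine_probability_le1.
have iH (p : probability R R) : p.-integrable setT (EFin \o H).
  apply: integrable_le1 => // x; have /andP[? ?] := H01 x.
  by rewrite ger0_norm.
have iI (p : probability R R) A : measurable A -> p.-integrable setT
  (EFin \o (\1_A : R -> R)).
  move=> mA; apply: integrable_le1 => [|x]; first exact: measurable_indic.
  by rewrite indicE; case: (_ \in _); rewrite ?normr1 ?normr0.
have II (p : probability R R) A : measurable A -> \int[p]_x
  (\1_A : R -> R) x = fine (p A).
  by move=> mA; rewrite /Rintegral integral_indic// setIT.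
have iK c (p : probability R R) : p.-integrable setT (EFin \o (fun=> c)).
  exact: finite_measure_integrable_cst.
have IK (p : probability R R) : \int[p]_x K = K.
  by rewrite Rintegral_cst//= probability_setT mulr1.
have lo : fine (nu `[a, b]%classic) - K <= \int[nu]_x H x.
  rewrite -II// -(IK nu) -RintegralB; [|by []|exact: iI|exact: iK].
  apply: le_Rintegral => //.
  - by apply: integrable_EFinD => //; [exact: iI|exact: iK].
  - exact: iH.
  move=> x _; rewrite indicE; have /andP[? ?] := H01 x.
  case: (boolP (x \in _)) => [|_];
    last by rewrite sub0r lerNl (le_trans _ K0)// oppr_le0.
  rewrite inE/= in_itv/= => /andP[ax xb].
  apply: normal_prob_itv_ge => //; first exact: ltW.
  by apply/andP; split; lra.
have hi n : \int[nu_ n]_x H x <=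
    fine (nu_ n `[a - 2 * eta, b + 2 * eta]%classic) + K.
  rewrite -II// -(IK (nu_ n)) -RintegralD; [|by []|exact: iI|exact: iK].
  apply: le_Rintegral => //.
  - exact: iH.
  - by apply: integrable_EFinD => //; [exact: iI|exact: iK].
  move=> x _; rewrite indicE; have /andP[? ?] := H01 x.
  case: (boolP (x \in _)) => [_|]; first by rewrite (le_trans (y := 1))// lerDl.
  rewrite notin_setE/= in_itv/= add0r => /negP; rewrite negb_and -!ltNge => xab.
  apply: normal_prob_itv_le => //; first exact: ltW.
  by case/orP: xab => h; [left|right]; lra.
have := cv (a - eta) (b + eta) s s0.
move/cvgrPdist_le => /(_ (e / 3)); case; first by rewrite divr_gt0.
move=> N _ cvN; exists N => // n /cvN; rewrite ler_norml => /andP[_ h].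
have := hi n; rewrite -/H in h. lra.
Qed.

(** Asymptotic lower bounds on intervals suffice because the total mass is 1: an interval to the
    left of [x] bounds the distribution function from below, and one to the right of [x], disjoint
    from the half-line, bounds it from above. *)
Lemma cvg_in_distribution_itv (R : realType) d d' (T : measurableType d)
    (T' : measurableType d') (P : probability T R) (P' : probability T' R)
    (X : nat -> {RV P >-> R}) (Z : {RV P' >-> R}) :
  (forall a b eta e : R, 0 < eta -> 0 < e -> \forall n \near \oo,
    fine (distribution P' Z `[a, b]%classic) - e <=
    fine (distribution P (X n) `[a - 2 * eta, b + 2 * eta]%classic)) ->
  cvg_in_distribution X Z.
Proof.
move=> lo x cZ.
pose F y := fine (cdf Z y).
have EF y : cdf Z y = (F y)%:E by rewrite fineK// fin_num_measure.
have cF : F y @[y --> x] --> F x.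
  by apply: fine_cvg; rewrite -EF; exact: cZ.
have F1 : F y @[y --> +oo] --> (1:R) by apply: fine_cvg; exact: cvg_cdfy1.
have F0 : F y @[y --> -oo] --> (0:R) by apply: fine_cvg; exact: cvg_cdfNy0.
rewrite EF; apply/fine_cvgP; split; first by apply: nearW => n;
  rewrite fin_num_measure.
apply/cvgrPdist_le => e e0; have e4 : 0 < e / 4 by rewrite divr_gt0.
have [dl /= dl0 Fdl] : \forall y \near x, `|F x - F y| <= e / 4.
  by move/cvgrPdist_le : cF; exact.
(* The points x - 2 eta and x + 3 eta stay within [dl] of [x]. After enlargement by 2 eta the left
   interval ends at [x] and the right one starts at x + eta, strictly beyond [x]. *)
pose eta := dl / 4; have eta0 : 0 < eta by rewrite divr_gt0.
have nx y : `|x - y| < dl -> `|F x - F y| <= e / 4 by move=> ?; apply: Fdl.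
have [a [_ Fa]] : exists a, True /\ F a <= e / 4.
  move/cvgrPdist_le : F0 => /(_ _ e4)[A [_ h]]; exists (A - 1); split => //.
  have := h (A - 1); rewrite ltrBlDr ltrDl ltr01 sub0r normrN => /(_ isT).
  by apply: le_trans; exact: ler_norm.
have [b [_ Fb]] : exists b, True /\ 1 - F b <= e / 4.
  move/cvgrPdist_le : F1 => /(_ _ e4)[A [_ h]]; exists (A + 1); split => //.
  have := h (A + 1); rewrite ltrDl ltr01 => /(_ isT).
  by apply: le_trans; exact: ler_norm.
have Fitv u v : F v - F u <= fine (distribution P' Z `[u, v]%classic).
  rewrite lerBlDl; apply: fine_probabilityU2 => // y /=; rewrite !in_itv/= => yv.
  by rewrite yv andbT; have [|/ltW] := leP u y; [right|left].
have := lo a (x - 2 * eta) eta (e / 4) eta0 e4.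
have := lo (x + 3 * eta) b eta (e / 4) eta0 e4.
apply: filterS2 => n h1 h2.
have h3 : fine (distribution P (X n) `[a - 2 * eta, x - 2 * eta + 2 * eta]%classic) <=
    fine (cdf (X n) x).
  apply: le_fine_probability => // y /=; rewrite !in_itv/= => /andP[_];
    rewrite subrK.
  exact.
have h4 : fine (distribution P (X n) `[x + 3 * eta - 2 * eta, b + 2 * eta]%classic) +
    fine (cdf (X n) x) <= 1.
  apply: fine_probability_disjU => //; apply/seteqP; split => y //= [].
  by rewrite !in_itv/= => /andP[h5 _] h6; lra.
have := Fitv a (x - 2 * eta); have := Fitv (x + 3 * eta) b.
have /ler_normlP[k2 k3] : `|F x - F (x - 2 * eta)| <= e / 4.
  by apply: nx; rewrite ltr_norml; apply/andP; split; rewrite /eta; lra.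
have /ler_normlP[k4 k5] : `|F x - F (x + 3 * eta)| <= e / 4.
  by apply: nx; rewrite ltr_norml; apply/andP; split; rewrite /eta; lra.
move=> k6 k7; rewrite ler_norml /=; apply/andP; split; lra.
Qed.

(** * Smoothing a law given by its density *)

Lemma ge0_integral_density (R : realType) d (T : measurableType d)
    (P : probability T R) (Z : {RV P >-> R}) (g f : R -> R) :
  has_density Z g -> measurable_fun setT f -> (forall x, 0 <= f x) ->
  (\int[distribution P Z]_x (f x)%:E =
   \int[lebesgue_measure]_x (f x * g x)%:E)%E.
Proof.
move=> [mg g0 Zg] mf f0.
(* Absolute continuity needs the law and Lebesgue measure on one measurable type, so [Z] is recast.
   The Radon-Nikodym derivative of its law then agrees almost everywhere with [g], and the change of
   variables formula applies. *)
have mZ : @measurable_fun _ _ T (measurableTypeR R) setT Z.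
  by move=> _ A mA; rewrite setTI; exact: (measurable_funPTI Z).
pose Z' : {mfun T >-> measurableTypeR R} :=
  @mfun_Sub _ _ T (measurableTypeR R) Z (mem_set mZ).
pose nu : {finite_measure set (measurableTypeR R) -> \bar R} := distribution P Z'.
pose mu : {sigma_finite_measure set
  (measurableTypeR R) -> \bar R} := @lebesgue_measure R.
have mf' : measurable_fun setT (fun x => (f x)%:E) by exact/measurable_EFinP.
have f0' x : (0 <= (f x)%:E)%E by rewrite lee_fin.
transitivity (\int[nu]_x (f x)%:E)%E.
  by rewrite ge0_integral_distribution//= [RHS]ge0_integral_distribution.
have dom : nu `<< mu.
  apply/null_content_dominatesP => A mA A0;
    rewrite /nu -[LHS]/(distribution P Z A) Zg//.
  by apply: null_set_integral => //; exact/measurable_EFinP/measurable_funTS.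
rewrite -(@Radon_Nikodym_SigmaFinite.change_of_variables _ _ _ nu mu dom)//.
apply: ae_eq_integral => //.
- apply: emeasurable_funM; first exact/measurable_EFinP.
  exact: measurable_int (@Radon_Nikodym_SigmaFinite.f_integrable _ _ _ nu mu dom).
- exact/measurable_EFinP/measurable_funM.
under [X in ae_eq _ _ _ X]eq_fun do rewrite EFinM.
apply: ae_eqe_mul2l; apply: integral_ae_eq => //.
- exact: (@Radon_Nikodym_SigmaFinite.f_integrable _ _ _ nu mu dom).
- exact/measurable_EFinP.
- by move=> A _ mA; rewrite -(@Radon_Nikodym_SigmaFinite.f_integral _ _ _ nu
  mu dom)//; exact: Zg.
Qed.

(** This matches the constant of the Fourier integral with the normalisations of the two dual
    Gaussians. *)
Lemma normal_peak_mulV (R : realType) (s : R) : 0 < s ->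
  normal_peak s * normal_peak s^-1 = (2 * pi)^-1.
Proof.
move=> s0; have p0 := pi_gt0 R.
rewrite /normal_peak -invfM -sqrtrM ?mulrn_wge0 ?mulr_ge0 ?sqr_ge0 ?ltW//.
rewrite (_ : s ^+ 2 * pi *+ 2 * (s^-1 ^+ 2 * pi *+ 2) = (2 * pi) ^+ 2);
  last first.
  by field; rewrite gt_eqF.
by rewrite sqrtr_sqr ger0_norm// mulr_ge0// ltW.
Qed.

(** This is the counterpart of [Rintegral_normal_pdf_cos] for the limit law, where [phi] is tied to
    [Z] only through the integral for [g]. As in Parseval's formula, exchanging the integrals leaves
    the known transform of a Gaussian in the inner one. *)
Lemma Rintegral_normal_pdf_density (R : realType) d (T : measurableType d)
    (P : probability T R) (Z : {RV P >-> R}) (g phi : R -> R) (y s : R) :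
  has_density Z g -> lebesgue_measure.-integrable setT (EFin \o phi) ->
  (forall x, g x =
     (2 * pi)^-1 * \int[lebesgue_measure]_k (cos (k * x) * phi k)) ->
  0 < s ->
  \int[distribution P Z]_x normal_pdf y s x = normal_peak s *
    \int[lebesgue_measure]_k (normal_pdf 0 s^-1 k * (cos (k * y) * phi k)).
Proof.
move=> Zg iphi gE s0.
rewrite /Rintegral (ge0_integral_density Zg)//; last 2 first.
- exact: measurable_normal_pdf.
- by move=> x; exact: normal_pdf_ge0.
rewrite -!/(Rintegral _ _ _).
have mphi : measurable_fun setT phi.
  by apply/measurable_EFinP; exact: (measurable_int lebesgue_measure).
have icphi x : lebesgue_measure.-integrable setT (EFin \o (fun k =>
  cos (k * x) * phi k)).
  apply: (@integrable_le _ _ R lebesgue_measure setT _ (fun k => `|phi k|)) => //.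
  - apply: measurable_funM => //.
    apply: (measurableT_comp (continuous_measurable_fun (@continuous_cos R))).
    exact: measurable_funM.
  - exact: integrable_norm.
  - by move=> k _; rewrite normrM ler_piMl// normr_cos_le1.
pose c : R := (2 * pi)^-1.
pose f (p : R * R) := c * (normal_pdf y s p.1 * (cos (p.2 * p.1) * phi p.2)).
have mf : measurable_fun setT f.
  apply: measurable_funM => //.
  apply: measurable_funM; first by apply: measurableT_comp => //;
    exact: measurable_normal_pdf.
  apply: measurable_funM; last exact: measurableT_comp.
  apply: (measurableT_comp (continuous_measurable_fun (@continuous_cos R))).
  exact: measurable_funM.
have fab (x k : R) : `|f (x, k)| <= normal_pdf y s x * (`|c| * `|phi k|).
  rewrite /f/= normrM [leRHS]mulrCA ler_wpM2l// !normrM.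
  rewrite ger0_norm ?normal_pdf_ge0// ler_wpM2l ?normal_pdf_ge0//.
  by rewrite ler_piMl// normr_cos_le1.
have iphi' : lebesgue_measure.-integrable setT (EFin \o (fun k =>
  `|c| * `|phi k|)).
  by apply: integrable_EFinZl => //; exact: integrable_norm.
have sw := @Rintegral_swap _ _ _ _ R lebesgue_measure lebesgue_measure _ _ _ mf
  (integrable_normal_pdf y s) iphi' fab.
transitivity (\int[lebesgue_measure]_x \int[lebesgue_measure]_k f (x, k)).
  apply: eq_Rintegral => x _; rewrite gE mulrCA.
  have ic1 := @integrable_EFinZl _ _ R lebesgue_measure setT _
    (normal_pdf y s x) measurableT (icphi x).
  by rewrite -(RintegralZl _ measurableT
    (icphi x)) -(RintegralZl _ measurableT ic1).
rewrite sw -RintegralZl//; last first.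
  apply: (@integrable_le _ _ R lebesgue_measure setT _
    (fun k => normal_peak s^-1 * `|phi k|)) => //.
  - apply: measurable_funM; first exact: measurable_normal_pdf.
    by apply/measurable_EFinP; exact: (measurable_int lebesgue_measure).
  - by apply: integrable_EFinZl => //; exact: integrable_norm.
  - move=> k _; rewrite normrM (@ger0_norm _
    (normal_pdf _ _ _)) ?normal_pdf_ge0//.
    apply: ler_pM => //; first exact: normal_pdf_ge0.
      by apply: normal_pdf_ub; rewrite gt_eqF// invr_gt0.
    by rewrite normrM; apply: ler_piMl => //; exact: normr_cos_le1.
apply: eq_Rintegral => k _; rewrite /f/=.
have ic : lebesgue_measure.-integrable setT
    (EFin \o (fun x : R => normal_pdf y s x * cos (k * x))).
  apply: integrable_normal_pdfM => [|x]; last exact: normr_cos_le1.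
  apply: (measurableT_comp (continuous_measurable_fun (@continuous_cos R))).
  exact: measurable_funM.
transitivity (c * phi k *
    \int[lebesgue_measure]_x (normal_pdf y s x * cos (k * x))).
  rewrite -(RintegralZl _ measurableT ic); apply: eq_Rintegral => x _; ring.
(* The Gaussian is centred at [y], so k x is written k (x - y) + k y, with phase k y. *)
have := @Rintegral_normal_cos R y s k (k * y) s0.
under [in X in X -> _]eq_Rintegral do rewrite mulrBr subrK.
move=> ->; rewrite normal_pdfE ?gt_eqF ?invr_gt0//.
rewrite /normal_fun (_ : expR (- (s * k) ^+ 2 / 2) =
  expR (- (k - 0) ^+ 2 / (s^-1 ^+ 2 *+ 2))); last first.
  by congr expR; field; rewrite gt_eqF.
have -> : c = normal_peak s * normal_peak s^-1 by rewrite normal_peak_mulV.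
by move: (phi k) (expR _) (cos _) (normal_peak s) (normal_peak s^-1) => *; ring.
Qed.

(** Letting the phase [th] vary encodes convergence of both the real and the imaginary part of the
    characteristic functions to the real function [phi]. The smoothed density at y uses th = - k
    y. *)
Lemma cvg_in_distribution_char (R : realType) d d' (T : measurableType d)
    (T' : measurableType d') (P : probability T R) (P' : probability T' R)
    (X : nat -> {RV P >-> R}) (Z : {RV P' >-> R}) (g phi : R -> R) :
  has_density Z g -> lebesgue_measure.-integrable setT (EFin \o phi) ->
  (forall x, g x =
     (2 * pi)^-1 * \int[lebesgue_measure]_k (cos (k * x) * phi k)) ->
  (forall k th, \int[P]_w cos (k * X n w + th) @[n --> \oo] -->
     cos th * phi k) ->
  cvg_in_distribution X Z.
Proof.
move=> Zg iphi gE hX; apply: cvg_in_distribution_itv.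
apply: near_le_probability_itv => a b s s0.
apply: cvg_Rintegral_normal_prob => // y.
rewrite (Rintegral_normal_pdf_density y Zg iphi gE s0).
apply: (cvg_Rintegral_normal_pdf (psi := fun k y => cos (k * y) * phi k)) => // k.
rewrite -cosN; apply: cvg_trans (hX k (- (k * y))); apply: near_eq_cvg.
apply: nearW => n; rewrite /Rintegral; congr fine.
have mc : measurable_fun setT (fun x : R => cos (k * (x - y))).
  apply: (measurableT_comp (continuous_measurable_fun (@continuous_cos R))).
  by apply: measurable_funM => //; exact: measurable_funB.
rewrite (@integral_distribution _ _ _ _ _ P (X n) (fun x =>
  (cos (k * (x - y)))%:E)).
- by apply: eq_integral => w _ /=; rewrite mulrBr.
- exact/measurable_EFinP.
- apply: (@integrable_le1 _ _ _ P (fun w => cos (k * (X n w - y)))).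
    exact: (measurableT_comp mc).
  by move=> w; exact: normr_cos_le1.
Qed.

(** * The characteristic function of the walk *)

Lemma Rintegral_bigcup d (T : measurableType d) (R : realType)
    (mu : {measure set T -> \bar R}) (F : nat -> set T) (f : T -> R) :
  (forall j, measurable (F j)) -> trivIset setT F ->
  mu.-integrable (\bigcup_j F j) (EFin \o f) ->
  series (fun j => \int[mu]_(x in F j) f x) @ \oo -->
  \int[mu]_(x in \bigcup_j F j) f x.
Proof.
move=> mF tF fi; pose D n := \big[setU/set0]_(j < n) F j.
have mU : measurable (\bigcup_j F j) by exact: bigcup_measurable.
have mD n : measurable (D n) by exact: bigsetU_measurable.
have DU n : D n `<=` \bigcup_j F j.
  by rewrite /D -bigcup_mkord => x [j _ Fjx]; exists j.
have sD n : series (fun j => \int[mu]_(x in F j) f x) n = \int[mu]_(x in D n) f x.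
  elim: n => [|n IH]; first by rewrite /series/= big_geq// /D big_ord0
    Rintegral_set0.
  rewrite seriesSr IH /D big_ord_recr/= Rintegral_setU//.
  - exact: mD.
  - rewrite -/(D n); apply: integrableS fi => //; first exact: measurableU.
    by move=> x [/DU//|Fx]; exists n.
  - apply/disj_setPS => x [].
    rewrite -bigcup_mkord => -[j /= jn Fjx] Fnx.
    by have := tF j n I I (ex_intro _ x (conj Fjx Fnx)) => jn';
      rewrite jn' ltnn in jn.
have [||||_] := @dominated_Rintegral_cvg _ _ R mu (\bigcup_j F j)
  (fun n => f \_ (D n)) f (fun x => `|f x|) mU.
- move=> n; apply: measurable_funS (measurableT) _ _ => //.
  apply/(measurable_restrictT _ (mD n)).
  have /measurable_EFinP mf := measurable_int _ fi.
  exact: measurable_funS mf.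
- move=> x [j _ Fjx]; apply: cvg_near_cst; near=> n; rewrite /= patchE ifT//.
  apply/mem_set; rewrite /D -bigcup_mkord; exists j => //=.
  by near: n; exact: nbhs_infty_gt.
- exact: integrable_norm.
- by move=> n x _; rewrite /= patchE; case: ifPn => // _; rewrite normr0.
apply: cvg_trans; apply: near_eq_cvg; apply: nearW => n.
by rewrite sD -Rintegral_mkcondr setIidr.
Unshelve. all: by end_near. Qed.

Lemma cvg_series_bigcup_probability d (T : measurableType d) (R : realType)
    (P : probability T R) (F : nat -> set T) :
  (forall j, measurable (F j)) -> trivIset setT F -> \bigcup_j F j = setT ->
  series (fun j => fine (P (F j))) @ \oo --> (1 : R).
Proof.
move=> mF tF FT.
have := @Rintegral_bigcup _ _ _ P F (fun=> 1) mF tF; rewrite FT.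
move=> /(_ (integrable_cst1 P)).
rewrite Rintegral_cst//= mul1r probability_setT/=.
by under [X in series X]eq_fun do rewrite Rintegral_cst// mul1r.
Qed.

(* The law of [|Y|] when [Y] has the symmetric law [p]. *)
Definition fold_law (R : realType) (p : int -> R) (j : nat) : R :=
  if j == 0%N then p 0 else 2 * p j%:Z.

Section walk.
Context (R : realType) (d : measure_display) (T : measurableType d)
  (P : probability T R) (Y : nat -> {RV P >-> int}) (p : int -> R).
Hypothesis indepY : mutually_independent Y.
Hypothesis lawY : forall (m : nat) (k : int),
  P (Y m @^-1` [set k]) = (p k)%:E.
Hypothesis symp : forall k, p (- k) = p k.

(** Pairing k with - k replaces a sum over the integers by a series over [nat], in which symmetry
    leaves only cosines. *)
Let G n (j : nat) : set T := Y n @^-1` [set k | `|k|%N = j].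

Let mpre n (B : set int) : measurable (Y n @^-1` B).
Proof. exact: measurable_funPTI. Qed.

Let G0 n : G n 0 = Y n @^-1` [set 0].
Proof. by apply/seteqP; split => w; rewrite /G/=; lia. Qed.

Let GS n j : G n j.+1 = Y n @^-1` [set j.+1%:Z] `|` Y n @^-1` [set - j.+1%:Z].
Proof. by apply/seteqP; split => w; rewrite /G/=; [|case]; lia. Qed.

Let tG n : trivIset setT (G n).
Proof. by apply/trivIsetP => i j _ _ /eqP ij; apply/seteqP; split => w;
  rewrite /G/= => // -[]; lia. Qed.

Let UG n : \bigcup_j G n j = setT.
Proof. by apply/seteqP; split => // w _; exists `|Y n w|%N. Qed.

Lemma fold_lawE n j : fine (P (G n j)) = fold_law p j.
Proof.
case: j => [|j]; first by rewrite G0 lawY.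
rewrite GS measureU//.
- by rewrite [X in (X + _)%E]lawY [X in (_ + X)%E]lawY symp/= /fold_law/=; lra.
- by apply/seteqP; split => w //= -[]; lia.
Qed.

Lemma fold_law_ge0 j : 0 <= fold_law p j.
Proof. by rewrite -(fold_lawE 0) fine_ge0. Qed.

Lemma cvg_series_fold_law : series (fold_law p) @ \oo --> (1 : R).
Proof.
have := @cvg_series_bigcup_probability _ _ _ P (G 0) (fun=> mpre _ _)
  (@tG 0) (UG 0).
by under [X in series X]eq_fun do rewrite fold_lawE.
Qed.

Lemma summable_fold_law (u : nat -> R) : (forall j, `|u j| <= 1) ->
  cvgn (series (fun j => fold_law p j * u j)).
Proof.
move=> u1; apply: normed_cvg; apply: (series_le_cvg _ _ _
  (cvgP _ cvg_series_fold_law)).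
- by move=> j; exact: normr_ge0.
- exact: fold_law_ge0.
- move=> j; rewrite /= normrM ger0_norm ?fold_law_ge0//.
  by rewrite ler_piMr ?fold_law_ge0.
Qed.

(** The characteristic function of a single step, real by symmetry. *)
Definition step_char (k : R) : R :=
  limn (series (fun j => fold_law p j * cos (k * j%:R))).

Let cylinder (J : {fset nat}) (B : nat -> set int) : set T :=
  \bigcap_(j in [set` J]) (Y j @^-1` B j).

Let mcylinder J B : measurable (cylinder J B).
Proof. by apply: bigcap_measurableType => j _; exact: mpre. Qed.

Let cylinderI J B n k : (forall j, j \in J -> (n < j)%N) ->
  cylinder J B `&` Y n @^-1` [set k] =
  cylinder (n |` J)%fset (fun j => if j == n then [set k] else B j).
Proof.
move=> nJ; rewrite /cylinder bigcap_fsetU1 eqxx setIC; congr (_ `&` _).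
apply: eq_bigcapr => j /= /nJ nj.
by case: eqP => // jn; move: nj; rewrite jn ltnn.
Qed.

Let probability_cylinderI J B n k : (forall j, j \in J -> (n < j)%N) ->
  fine (P (cylinder J B `&` Y n @^-1` [set k])) = p k * fine (P (cylinder J B)).
Proof.
move=> nJ.
have nnJ : n \notin J by apply/negP => /nJ; rewrite ltnn.
have mset i : measurable ((fun j => if j == n then [set k] else B j) i) by [].
rewrite (cylinderI _ _ nJ) /cylinder indepY// big_fsetU1//= eqxx lawY.
rewrite (eq_big_seq (fun j => P (Y j @^-1` B j))); last first.
  by move=> j /nJ nj; case: eqP => // jn; move: nj; rewrite jn ltnn.
have PJ : P (cylinder J B) = (\prod_(j <- J) P
  (Y j @^-1` B j))%E by exact: indepY.
by rewrite -PJ fineM//; exact: fin_num_measure.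
Qed.

(** The induction is on the number of steps summed, for all phases and for all events on the steps
    from index [n] on. On [Y n = i] the last summand turns into a phase k i and the event joins the
    cylinder, so independence enters only through cylinder probabilities. *)
Lemma Rintegral_cos_walk (k th : R) (n : nat) (J : {fset nat})
  (B : nat -> set int) :
  (forall j, j \in J -> (n <= j)%N) ->
  \int[P]_(w in \bigcap_(j in [set` J]) (Y j @^-1` B j))
     cos (scaled_walk k Y n w + th) =
  cos th * step_char k ^+ n *
  fine (P (\bigcap_(j in [set` J]) (Y j @^-1` B j))).
Proof.
elim: n th J B => [|n IH] th J B nJ; rewrite -/(cylinder J B).
  under eq_Rintegral do rewrite /scaled_walk big_ord0 mulr0 add0r.
  by rewrite Rintegral_cst ?mulr1.
set C := cylinder J B.
have mf m t : measurable_fun setT (fun w => cos (scaled_walk k Y m w + t)).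
  apply: (measurableT_comp (continuous_measurable_fun (@continuous_cos R))).
  by apply: measurable_funD => //; exact: measurable_scaled_walk.
have intf m t D : measurable D ->
    P.-integrable D (EFin \o (fun w => cos (scaled_walk k Y m w + t))).
  move=> mD; apply: integrableS (@integrable_le1 _ _ _ P _ (mf m t) _) => // w.
  exact: normr_cos_le1.
have slice i : \int[P]_(w in C `&` Y n @^-1` [set i]) cos
  (scaled_walk k Y n.+1 w + th)
    = cos (k * i%:~R + th) * step_char k ^+ n * (p i * fine (P C)).
  rewrite -(probability_cylinderI _ i nJ) (cylinderI _ _ nJ) -IH.
    apply: eq_Rintegral => w /set_mem;
      rewrite /cylinder bigcap_fsetU1 eqxx => -[/= Yn _].
    by rewrite /scaled_walk big_ord_recr/= Yn rmorphD/= mulrDr addrA.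
  move=> j; rewrite in_fset1U => /orP[/eqP->//|/nJ]; exact: ltnW.
have CU : C = \bigcup_j (C `&` G n j) by rewrite -setI_bigcupr UG setIT.
have := @Rintegral_bigcup _ _ _ P (fun j => C `&` G n j)
  (fun w => cos (scaled_walk k Y n.+1 w + th)).
rewrite -CU => /(_ (fun j => measurableI _ _ (mcylinder J B) (mpre n _))).
have tC : trivIset setT (fun j => C `&` G n j) by apply: trivIset_setIl;
  exact: tG.
move=> /(_ tC (intf _ _ _ (mcylinder J B))).
have mCI i : measurable (C `&` Y n @^-1` [set i]).
  by apply: measurableI; [exact: mcylinder|exact: mpre].
(* The slices at j and - j have equal weight, and cos(k j + th) + cos(- k j + th) = 2 cos(k j)
   cos(th). *)
have term j : \int[P]_(w in C `&` G n j) cos (scaled_walk k Y n.+1 w + th) =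
    cos th * step_char k ^+ n * fine (P C) * (fold_law p j * cos (k * j%:R)).
  case: j => [|j]; first by rewrite G0 slice /fold_law/= mulr0 add0r cos0; ring.
  rewrite GS setIUr Rintegral_setU; last 4 first.
  - exact: mCI.
  - exact: mCI.
  - by apply: intf; apply: measurableU; exact: mCI.
  - by apply/disj_setPS => w [[_ /= ->] [_ /=]]; lia.
  rewrite !slice symp /fold_law/= rmorphN/= mulrN.
  rewrite !cosD cosN sinN -!pmulrn; ring.
under [X in series X]eq_fun do rewrite term.
move=> h1.
have h2 : series (fun j => cos th * step_char k ^+ n * fine (P C) *
    (fold_law p j * cos (k * j%:R))) @ \oo -->
    cos th * step_char k ^+ n * fine (P C) * step_char k.
  rewrite (_ : series _ = fun m => (cos th * step_char k ^+ n * fine (P C)) *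
     series (fun j => fold_law p j * cos (k * j%:R)) m); last first.
    by apply/funext => m; rewrite /series/= mulr_sumr.
  apply: cvgM; first exact: cvg_cst.
  by apply: summable_fold_law => j; exact: normr_cos_le1.
rewrite (cvg_unique _ h1 h2)// exprSr; ring.
Qed.

End walk.

(** * The generating function of the steps *)

(** Each of the n + 1 terms of 1 + u + ... + u^n is at least u^n, and this geometric sum is at most
    1 / (1 - u). *)
Lemma succn_expr_le (R : realFieldType) (u : R) (n : nat) : 0 <= u < 1 ->
  n.+1%:R * u ^+ n <= (1 - u)^-1.
Proof.
move=> /andP[u0 u1]; rewrite -[leRHS]mul1r ler_pdivlMr ?subr_gt0//.
rewrite (@le_trans _ _ (1 - u ^+ n.+1))//; last by rewrite gerBl exprn_ge0.
rewrite -[X in _ <= X - _](expr1n _ n.+1) subrXX mulrC ler_wpM2l//.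
  by rewrite subr_ge0 ltW.
rewrite -[X in X%:R * _](card_ord n.+1) -sumr_const mulr_suml.
apply: ler_sum => i _; rewrite mul1r expr1n mul1r.
by apply: ler_wiXn2l => //; [exact: ltW|rewrite -ltnS].
Qed.

(** At the point u^3 the power u^(3 n) splits into three factors u^n: two absorb the linear factors
    of the bound and the third is summed as a geometric series. *)
Lemma is_cvg_pseries_quadratic (R : realType) (g : nat -> R) (M u : R) :
  (forall n, `|g n| <= M * (n.+1 * n.+2)%:R) -> 0 < u < 1 ->
  cvgn (pseries g (u ^+ 3)).
Proof.
move=> gM /andP[u0 u1]; have u0' := ltW u0.
have M0 : 0 <= M by rewrite -(pmulr_lge0 _ (_ : 0 < 2)) // (le_trans _ (gM 0)).
have v0 : 0 <= (1 - u)^-1 by rewrite invr_ge0 subr_ge0 ltW.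
apply: normed_cvg.
apply: (series_le_cvg _ _ _ (is_cvg_geometric_series
  (a := M * (2 * (1 - u)^-1 ^+ 2)) (z := u) _)) => //.
- by move=> n; exact: normr_ge0.
- by move=> n; rewrite /geometric/= !mulr_ge0 ?exprn_ge0.
- move=> n; rewrite /= normrM (@ger0_norm _ ((u ^+ 3) ^+ n)) ?exprn_ge0//.
  have h : n.+1%:R * u ^+ n <= (1 - u)^-1 by apply: succn_expr_le; rewrite u0'.
  have h2 : n.+2%:R * u ^+ n <= 2 * (1 - u)^-1.
    apply: le_trans (ler_wpM2l _ h) => //; rewrite mulrA ler_wpM2r ?exprn_ge0//.
    by rewrite -natrM ler_nat; lia.
  rewrite -exprM (_ : (3 * n)%N = (n + (n + n))%N) ?exprD; last by lia.
  apply: le_trans (ler_wpM2r _ (gM n)) _; first by rewrite !mulr_ge0 ?exprn_ge0.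
  rewrite natrM.
  have -> : M * (n.+1%:R * n.+2%:R) * (u ^+ n * (u ^+ n * u ^+ n)) =
      M * ((n.+1%:R * u ^+ n) * (n.+2%:R * u ^+ n)) * u ^+ n by ring.
  rewrite ler_wpM2r ?exprn_ge0// ler_wpM2l//.
  rewrite (le_trans (ler_pM _ _ h h2)) ?mulr_ge0 ?exprn_ge0//.
  by rewrite expr2 mulrCA.
- by rewrite ger0_norm.
Qed.

(** Here [u] is the arithmetic mean of 1, 1 and |x|, so u^3 > |x| by the inequality of the means.
    This gives a point u^3 of the disk beyond x for [is_cvg_pseries_quadratic]. *)
Lemma lt_cube (R : realFieldType) (x : R) : `|x| < 1 ->
  let u := (2 + `|x|) / 3 in 0 < u < 1 /\ `|x| < `|u ^+ 3|.
Proof.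
move=> x1 u; have x0 := normr_ge0 x.
have u01 : 0 < u < 1 by rewrite /u; apply/andP; split; lra.
split => //; have /andP[u0 u1] := u01.
rewrite [ltRHS]ger0_norm ?exprn_ge0 ?ltW// -subr_gt0.
rewrite (_ : _ - _ = (1 - `|x|) ^+ 2 * (`|x| + 8) / 27).
  by rewrite !mulr_gt0 ?exprn_gt0 ?subr_gt0 ?invr_gt0 ?ltr_wpDl.
by rewrite /u; field.
Qed.

Section bounded_pseries.
Variables (R : realType) (f : nat -> R) (M x : R).
Hypothesis fM : forall n, `|f n| <= M.
Hypothesis x1 : `|x| < 1.

Let M0 : 0 <= M. Proof. by rewrite (le_trans _ (fM 0)). Qed.

Let u := (2 + `|x|) / 3.

Let cvg0 : cvgn (pseries f (u ^+ 3)).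
Proof.
apply: (@is_cvg_pseries_quadratic _ _ M) => [n|]; last exact: (lt_cube x1).1.
by rewrite (le_trans (fM n))// ler_peMr// ler1n.
Qed.

Let cvg1 : cvgn (pseries (pseries_diffs f) (u ^+ 3)).
Proof.
apply: (@is_cvg_pseries_quadratic _ _ M) => [n|]; last exact: (lt_cube x1).1.
rewrite /pseries_diffs normrM normr_nat mulrC; apply: ler_pM => //.
by rewrite ler_nat leq_pmulr.
Qed.

(** Termwise differentiation at x asks for the series and its first two formal derivatives at a
    point beyond x; the second one has the quadratic growth allowed above. *)
Let cvg2 : cvgn (pseries (pseries_diffs (pseries_diffs f)) (u ^+ 3)).
Proof.
apply: (@is_cvg_pseries_quadratic _ _ M) => [n|]; last exact: (lt_cube x1).1.
rewrite /pseries_diffs !normrM !normr_nat mulrA -natrM mulrC.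
exact: ler_pM.
Qed.

Lemma is_cvg_pseries_bounded : cvgn (pseries f x).
Proof. exact: is_cvg_pseries_inside cvg0 (lt_cube x1).2. Qed.

Lemma is_cvg_pseries_diffs_bounded : cvgn (pseries (pseries_diffs f) x).
Proof. exact: is_cvg_pseries_inside cvg1 (lt_cube x1).2. Qed.

Lemma is_derive_pseries_bounded :
  is_derive x (1 : R) (fun x => limn (pseries f x))
    (limn (pseries (pseries_diffs f) x)).
Proof. exact: (pseries_snd_diffs cvg0 cvg1 cvg2 (lt_cube x1).2). Qed.

End bounded_pseries.

(** With z = C + i S and F(r) the sum of q_j z^j r^j, this is one component of (1 - r z) F' + alpha
    z F = 2 q_2 z^2 r. Taking (cos, sin, S) gives the real part and (sin, cos, - S) the imaginary
    part. *)
Lemma pseries_recurrence (R : realType) (q x y : nat -> R) (alpha C S r M : R) :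
  q 0%N = 0 -> q 1%N = 0 ->
  (forall j, (2 <= j)%N -> j.+1%:R * q j.+1 = (j%:R - alpha) * q j) ->
  (forall j, x j.+1 = C * x j - S * y j) ->
  (forall j, `|q j * x j| <= M) -> (forall j, `|q j * y j| <= M) ->
  `|r| < 1 ->
  let a j := q j * x j in let b j := q j * y j in
  let A := limn (pseries a r) in let B := limn (pseries b r) in
  let A' := limn (pseries (pseries_diffs a) r) in
  let B' := limn (pseries (pseries_diffs b) r) in
  A' - r * (C * A' - S * B') + alpha * (C * A - S * B) = 2 * q 2%N * r * x 2%N.
Proof.
move=> q0 q1 qS xS xM yM r1 a b A B A' B'.
have cA := is_cvg_pseries_bounded xM r1.
have cB := is_cvg_pseries_bounded yM r1.
have cA' := is_cvg_pseries_diffs_bounded xM r1.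
have cB' := is_cvg_pseries_diffs_bounded yM r1.
pose t j := pseries_diffs a j * r ^+ j -
  r * (C * (j%:R * a j * r ^+ j.-1) - S * (j%:R * b j * r ^+ j.-1)) +
  alpha * (C * (a j * r ^+ j) - S * (b j * r ^+ j)).
have ht : series t @ \oo --> A' - r * (C * A' - S * B') + alpha * (C * A - S * B).
  rewrite (_ : series t = fun n => pseries (pseries_diffs a) r n -
     r * (C * (series (fun j => j%:R * a j * r ^+ j.-1) n) - S *
       (series (fun j => j%:R * b j * r ^+ j.-1) n)) +
     alpha * (C * pseries a r n - S * pseries b r n)); last first.
    by apply/funext => n; rewrite /pseries /series/= !mulr_sumr -!sumrB
      !mulr_sumr -!sumrB -big_split.
  apply: cvgD.
    apply: cvgB; first exact: cA'.
    apply: cvgM; first exact: cvg_cst.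
    apply: cvgB; (apply: cvgM; first exact: cvg_cst); exact: pseries_diffs_equiv.
  apply: cvgM; first exact: cvg_cst.
  by apply: cvgB; (apply: cvgM; first exact: cvg_cst).
have tE j : t j = if j == 1%N then 2 * q 2%N * r * x 2%N else 0.
  rewrite /t /pseries_diffs /a /b.
  case: j => [|[|j]].
  - by rewrite !(q0, q1, mul0r, mulr0, subr0, addr0).
  - by rewrite /= q1; ring.
  - have := qS j.+2 isT; rewrite /= (exprS r j.+1) => h.
    rewrite [X in X * _ - _](_ : _ = (j.+2%:R - alpha) * q j.+2 * x j.+3);
      last by rewrite -h; ring.
    rewrite (xS j.+2); ring.
have h2 : series t @ \oo --> 2 * q 2%N * r * x 2%N.
  apply: cvg_near_cst; near=> n.
  have n2 : (2 <= n)%N by near: n; exact: nbhs_infty_ge.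
  rewrite /series/= (eq_bigr _ (fun j _ => tE j)).
  rewrite big_ltn ?(ltnW n2)// big_ltn//= add0r big_nat big1 ?addr0//.
  by move=> j /andP[j2 _]; case: eqP => // j1; move: j2; rewrite j1.
exact: (cvg_unique _ ht h2).
Unshelve. all: by end_near. Qed.

(** For z = C + i S on the unit circle these are the real part and the squared modulus of 1 - r z.
    Positivity of the real part is what allows [atan] to give its argument. *)
Lemma sqr_dist_circle_gt0 (R : realFieldType) (C r : R) : `|C| <= 1 -> `|r| < 1 ->
  0 < 1 - r * C /\ 0 < 1 - 2 * r * C + r ^+ 2.
Proof.
move=> C1 r1; have rC : r * C < 1.
  rewrite (le_lt_trans (ler_norm _))// normrM.
  by rewrite (le_lt_trans _ r1)// ler_piMr.
split; first by rewrite subr_gt0.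
rewrite (_ : _ + _ = (1 - r * C) ^+ 2 + r ^+ 2 * (1 - C ^+ 2)); last by ring.
rewrite ltr_wpDr ?exprn_gt0 ?subr_gt0// mulr_ge0 ?sqr_ge0// subr_ge0.
by rewrite -real_normK ?num_real// expr_le1.
Qed.

Lemma is_derive_sqr_dist_circle (R : realType) (C r : R) :
  is_derive r 1 (fun x : R => 1 - 2 * x * C + x ^+ 2) (2 * (r - C)).
Proof. apply: is_derive_eq; rewrite /GRing.scale/=; ring. Qed.

(* [d = d1 + i d2] solves [(1 - r z) d' = - alpha z d] with [z = C + i S], and
   [|d|^2 |1 - r z|^(-2 alpha)] is a first integral of this equation. *)
Lemma linear_ode_unique (R : realType) (C S alpha : R) (d1 d2 : R -> R) :
  `|C| <= 1 ->
  (forall r : R, `|r| < 1 -> is_derive r 1 d1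
     (- alpha * ((C - r) * d1 r - S * d2 r) / (1 - 2 * r * C + r ^+ 2))) ->
  (forall r : R, `|r| < 1 -> is_derive r 1 d2
     (- alpha * ((C - r) * d2 r + S * d1 r) / (1 - 2 * r * C + r ^+ 2))) ->
  d1 0 = 0 -> d2 0 = 0 ->
  forall r, 0 <= r < 1 -> d1 r = 0 /\ d2 r = 0.
Proof.
move=> C1 hd1 hd2 d10 d20 r /andP[r0 r1].
pose rho2 (x : R) := 1 - 2 * x * C + x ^+ 2.
pose E (x : R) := (d1 x ^+ 2 + d2 x ^+ 2) * expR (- alpha * ln (rho2 x)).
have dE (x : R) : `|x| < 1 -> is_derive x 1 E 0.
  move=> x1; have [_ rho0] := sqr_dist_circle_gt0 C1 x1.
  have dd1 := hd1 x x1; have dd2 := hd2 x x1.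
  have dr := is_derive_sqr_dist_circle C x.
  have dln := is_derive1_ln rho0.
  have dlr : is_derive x 1 (fun x => ln (rho2 x)) ((rho2 x)^-1 * (2 * (x - C))).
    exact: is_derive1_comp.
  apply: is_derive_eq; rewrite /GRing.scale/= /rho2.
  by field; rewrite gt_eqF.
have E0 : E 0 = 0 by rewrite /E d10 d20 expr0n/= addr0 mul0r.
have Er : E r = 0.
  rewrite -E0; apply/eqP; rewrite -subr_eq0; apply/eqP.
  have [| | c _ ->] := @MVT_segment R E (fun=> 0) 0 r r0; last by rewrite mul0r.
  - move=> x; rewrite in_itv/= => /andP[x0 xr]; apply: dE.
    by rewrite ger0_norm ?(ltW x0)// (lt_trans xr).
  - apply: derivable_within_continuous => x; rewrite in_itv/= => /andP[x0 xr].
    have /dE[] // : `|x| < 1 by rewrite ger0_norm// (le_lt_trans xr).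
move/eqP: Er; rewrite mulf_eq0 (gt_eqF (expR_gt0 _)) orbF.
rewrite paddr_eq0 ?sqr_ge0// !sqrf_eq0 => /andP[/eqP-> /eqP->].
by [].
Qed.

(** The complex equation is solved for F' by multiplying with the conjugate of 1 - r z, using z (1 -
    r conj z) = z - r on the unit circle. *)
Lemma solve_rotated_system (R : comPzRingType) (x y A B C S r alpha k : R) :
  S ^+ 2 = 1 - C ^+ 2 ->
  x - r * (C * x - S * y) + alpha * (C * A - S * B) = k * r * (C ^+ 2 - S ^+ 2) ->
  y - r * (C * y - - S * x) + alpha * (C * B - - S * A) = k * r * (2 * C * S) ->
  x * (1 - 2 * r * C + r ^+ 2) =
    - alpha * ((C - r) * A - S * B) + k * r * (C * (C - r) - S ^+ 2) /\
  y * (1 - 2 * r * C + r ^+ 2) =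
    - alpha * ((C - r) * B + S * A) + k * r * (S * (C - r) + C * S).
Proof.
move=> CS /eqP; rewrite -subr_eq0 => /eqP e1 /eqP; rewrite -subr_eq0 => /eqP e2.
split; apply/eqP; rewrite -subr_eq0; apply/eqP.
(* The last summand, a multiple of S^2 - (1 - C^2), makes this a polynomial identity; the other two
   are multiples of the hypotheses. *)
- transitivity ((1 - r * C) * (x - r * (C * x - S * y) + alpha * (C * A - S * B) -
      k * r * (C ^+ 2 - S ^+ 2)) -
    r * S * (y - r * (C * y - - S * x) + alpha * (C * B - - S * A) -
      k * r * (2 * C * S)) +
    (S ^+ 2 - (1 - C ^+ 2)) * (- r * r * x + alpha * r * A - k * r ^+ 2 * C)).
    ring.
  by rewrite e1 e2 CS subrr; ring.
- transitivity (r * S * (x - r * (C * x - S * y) + alpha * (C * A - S * B) -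
      k * r * (C ^+ 2 - S ^+ 2)) +
    (1 - r * C) * (y - r * (C * y - - S * x) + alpha * (C * B - - S * A) -
      k * r * (2 * C * S)) +
    (S ^+ 2 - (1 - C ^+ 2)) * (- r * r * y + alpha * r * B - k * r ^+ 2 * S)).
    ring.
  by rewrite e1 e2 CS subrr; ring.
Qed.

Lemma lim_pseries0 (R : realType) (f : nat -> R) : limn (pseries f 0) = f 0%N.
Proof.
apply/cvg_lim => //; apply: cvg_near_cst; near=> n.
have n0 : (0 < n)%N by near: n; exact: nbhs_infty_gt.
rewrite /pseries /series/= big_ltn// expr0 mulr1 big_nat big1 ?addr0// =>
  j /andP[j0 _].
by rewrite expr0n eqn0Ngt j0 mulr0.
Unshelve. all: by end_near. Qed.

Section generating_function.
Context (R : realType) (q : nat -> R) (alpha s M : R).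
Hypothesis q0 : q 0%N = 0.
Hypothesis q1 : q 1%N = 0.
Hypothesis qS : forall j, (2 <= j)%N -> j.+1%:R * q j.+1 = (j%:R - alpha) * q j.
Hypothesis qM : forall j, `|q j| <= M.

Let C := cos s.
Let S := sin s.
Let rho2 (r : R) := 1 - 2 * r * C + r ^+ 2.
Let a j := q j * cos (j%:R * s).
Let b j := q j * sin (j%:R * s).
Let A r := limn (pseries a r).
Let B r := limn (pseries b r).

Let C1 : `|C| <= 1. Proof. exact: normr_cos_le1. Qed.

Let CS : S ^+ 2 = 1 - C ^+ 2. Proof. by rewrite -(cos2Dsin2 s) addrC addKr. Qed.

Let aM j : `|a j| <= M.
Proof. by rewrite normrM (le_trans _ (qM j))// ler_piMr// normr_cos_le1. Qed.

Let bM j : `|b j| <= M.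
Proof. by rewrite normrM (le_trans _ (qM j))// ler_piMr// normr_sin_le1. Qed.

Let A' r := limn (pseries (pseries_diffs a) r).
Let B' r := limn (pseries (pseries_diffs b) r).

Let ode r : `|r| < 1 ->
  A' r = - alpha * ((C - r) * A r - S * B r) / rho2 r +
    2 * q 2%N * r * (C * (C - r) - S ^+ 2) / rho2 r /\
  B' r = - alpha * ((C - r) * B r + S * A r) / rho2 r +
    2 * q 2%N * r * (S * (C - r) + C * S) / rho2 r.
Proof.
move=> r1; have [_ rho0] := sqr_dist_circle_gt0 C1 r1.
have e1 : A' r - r * (C * A' r - S * B' r) + alpha * (C * A r - S * B r) =
    2 * q 2%N * r * (C ^+ 2 - S ^+ 2).
  have -> : C ^+ 2 - S ^+ 2 = cos (2%:R * s) by rewrite (_ : 2%:R * s =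
    s + s) ?cosD -?expr2//; ring.
  apply: (@pseries_recurrence R q (fun j => cos (j%:R * s)) (fun j =>
    sin (j%:R * s))
    alpha C S r M q0 q1 qS _ aM bM r1) => j.
  by rewrite -natr1 mulrDl mul1r cosD mulrC [sin _ * _]mulrC.
have e2 : B' r - r * (C * B' r - - S * A' r) + alpha * (C * B r - - S * A r) =
    2 * q 2%N * r * (2 * C * S).
  have -> : 2 * C * S = sin (2%:R * s).
    by rewrite (_ : 2%:R * s = s + s) ?sinD; rewrite /C /S; ring.
  apply: (@pseries_recurrence R q (fun j => sin (j%:R * s)) (fun j =>
    cos (j%:R * s))
    alpha C (- S) r M q0 q1 qS _ bM aM r1) => j.
  by rewrite -natr1 mulrDl mul1r sinD -/C -/S; ring.
have [xE yE] := solve_rotated_system CS e1 e2.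
have rn : rho2 r != 0 by rewrite gt_eqF.
by split; apply: (mulIf rn); rewrite mulrDl !divfK.
Qed.

(** The source term cancels in the difference, which therefore solves the homogeneous equation of
    [linear_ode_unique] with zero initial value. *)
Let generating_function_unique (F1 F2 : R -> R) :
  (forall r : R, `|r| < 1 -> is_derive r 1 F1
    (- alpha * ((C - r) * F1 r - S * F2 r) / rho2 r +
     2 * q 2%N * r * (C * (C - r) - S ^+ 2) / rho2 r)) ->
  (forall r : R, `|r| < 1 -> is_derive r 1 F2
    (- alpha * ((C - r) * F2 r + S * F1 r) / rho2 r +
     2 * q 2%N * r * (S * (C - r) + C * S) / rho2 r)) ->
  F1 0 = 0 -> F2 0 = 0 ->
  forall r, 0 <= r < 1 -> A r = F1 r /\ B r = F2 r.
Proof.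
move=> hF1 hF2 F10 F20 r r01.
pose d1 x := A x - F1 x; pose d2 x := B x - F2 x.
have [||||] := @linear_ode_unique R C S alpha d1 d2 C1 _ _ _ _ r r01.
- move=> x x1; have := hF1 x x1; have := is_derive_pseries_bounded aM x1.
  rewrite -/(A' x) (ode x1).1 => dA dF1; rewrite /d1; apply: is_derive_eq.
  by rewrite /d2 -/(rho2 x); ring.
- move=> x x1; have := hF2 x x1; have := is_derive_pseries_bounded bM x1.
  rewrite -/(B' x) (ode x1).2 => dB dF2; rewrite /d2; apply: is_derive_eq.
  by rewrite /d1 -/(rho2 x); ring.
- by rewrite /d1 F10 /A lim_pseries0 /a q0 mul0r subr0.
- by rewrite /d2 F20 /B lim_pseries0 /b q0 mul0r subr0.
- by move=> /eqP; rewrite subr_eq0 => /eqP -> /eqP; rewrite subr_eq0 => /eqP.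
Qed.

(** Minus the argument of 1 - r z, so that log(1 - r z) = ln (rho2 r) / 2 - i psi(r). *)
Let psi (r : R) := atan (r * S / (1 - r * C)).

Let rho20 : rho2 0 = 1. Proof. by rewrite /rho2; ring. Qed.

Let psi0 : psi 0 = 0. Proof. by rewrite /psi !mul0r atan0. Qed.

Let is_derive_ln_rho2 (r : R) : `|r| < 1 ->
  is_derive r 1 (fun x => ln (rho2 x)) (2 * (r - C) / rho2 r).
Proof.
move=> r1; have [_ rho0] := sqr_dist_circle_gt0 C1 r1.
have dr := is_derive_sqr_dist_circle C r.
have dln := is_derive1_ln rho0.
have dlr : is_derive r 1 (fun x => ln (rho2 x)) ((rho2 r)^-1 * (2 * (r - C))).
  exact: is_derive1_comp.
by apply: is_derive_eq; rewrite mulrC.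
Qed.

Let is_derive_psi (r : R) : `|r| < 1 -> is_derive r 1 psi (S / rho2 r).
Proof.
move=> r1; have [rC rho0] := sqr_dist_circle_gt0 C1 r1.
have rC0 : 1 - r * C != 0 by rewrite gt_eqF.
pose g (x : R) := x * S / (1 - x * C).
have dg : is_derive r 1 g (S / (1 - r * C) ^+ 2).
  have di : is_derive r 1 (fun x : R => (1 - x * C)^-1) (C / (1 - r * C) ^+ 2).
    have dl : is_derive r 1 (fun x : R => 1 - x * C) (- C).
      by apply: is_derive_eq; rewrite /GRing.scale/=; ring.
    by apply: is_derive_eq; rewrite /GRing.scale/=; field.
  by apply: is_derive_eq; rewrite /GRing.scale/=; field.
have datan := is_derive1_atan (g r).
have dp : is_derive r 1 psi ((1 + g r ^+ 2)^-1 * (S / (1 - r * C) ^+ 2)).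
  exact: is_derive1_comp.
apply: is_derive_eq; rewrite /g /rho2.
have rhoE : 1 - 2 * r * C + r ^+ 2 = (1 - r * C) ^+ 2 + (r * S) ^+ 2.
  by rewrite exprMn CS; ring.
have rho1 : (1 - r * C) ^+ 2 + (r * S) ^+ 2 != 0 by rewrite -rhoE gt_eqF.
by rewrite rhoE; field; rewrite rho1.
Qed.

(** These are the real and imaginary parts of K ((1 - r z)^alpha - 1 + alpha r z): the binomial
    series without its terms of degree 0 and 1, with [K] matching the coefficient of degree 2. *)
Lemma generating_function_powE (K : R) : K * (alpha * (alpha - 1)) = 2 * q 2%N ->
  forall r, 0 <= r < 1 ->
  A r = K * (expR (alpha / 2 * ln (rho2 r)) * cos (alpha * psi r) - 1 +
             alpha * r * C) /\
  B r = K * (- (expR (alpha / 2 * ln (rho2 r)) * sin (alpha * psi r)) +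
             alpha * r * S).
Proof.
move=> KE; apply: generating_function_unique.
- move=> r r1; have [_ rho0] := sqr_dist_circle_gt0 C1 r1.
  have dL := is_derive_ln_rho2 r1; have dP := is_derive_psi r1.
  apply: is_derive_eq; rewrite /GRing.scale/= -KE.
  move: (expR _) (cos _) (sin _) => e c s'.
  apply/eqP; rewrite -subr_eq0; apply/eqP.
  (* The two sides agree only modulo C^2 + S^2 = 1, so the multiple of this relation is made
     explicit. *)
  transitivity (K * alpha * r * ((1 - C ^+ 2) - S ^+ 2) / rho2 r).
    by rewrite /rho2; field; rewrite gt_eqF.
  by rewrite CS subrr mulr0 mul0r.
- move=> r r1; have [_ rho0] := sqr_dist_circle_gt0 C1 r1.
  have dL := is_derive_ln_rho2 r1; have dP := is_derive_psi r1.
  apply: is_derive_eq; rewrite /GRing.scale/= -KE.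
  move: (expR _) (cos _) (sin _) => e c s'.
  by rewrite /rho2; field; rewrite gt_eqF.
- by rewrite rho20 psi0 ln1 !mulr0 expR0 cos0; ring.
- by rewrite rho20 psi0 ln1 !mulr0 expR0 sin0; ring.
Qed.

(** At alpha = 1 the factor alpha (alpha - 1) vanishes and the power is replaced by a logarithm: the
    solution is 2 q_2 (r z + (1 - r z) log(1 - r z)). *)
Lemma generating_function_logE : alpha = 1 ->
  forall r, 0 <= r < 1 ->
  A r = 2 * q 2%N * (r * C + (1 - r * C) * (ln (rho2 r) / 2) - r * S * psi r) /\
  B r = 2 * q 2%N * (r * S - (1 - r * C) * psi r - r * S * (ln (rho2 r) / 2)).
Proof.
move=> a1; apply: generating_function_unique.
- move=> r r1; have [_ rho0] := sqr_dist_circle_gt0 C1 r1.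
  have dL := is_derive_ln_rho2 r1; have dP := is_derive_psi r1.
  apply: is_derive_eq; rewrite /GRing.scale/= a1.
  move: (ln _) (psi _) (q 2) => l p q2.
  apply/eqP; rewrite -subr_eq0; apply/eqP.
  transitivity (2 * q2 * (1 - l / 2) * r * ((1 - C ^+ 2) - S ^+ 2) / rho2 r).
    by rewrite /rho2; field; rewrite gt_eqF.
  by rewrite CS subrr mulr0 mul0r.
- move=> r r1; have [_ rho0] := sqr_dist_circle_gt0 C1 r1.
  have dL := is_derive_ln_rho2 r1; have dP := is_derive_psi r1.
  apply: is_derive_eq; rewrite /GRing.scale/= a1.
  move: (ln _) (psi _) (q 2) => l p q2.
  apply/eqP; rewrite -subr_eq0; apply/eqP.
  transitivity (2 * q2 * p * r * ((1 - C ^+ 2) - S ^+ 2) / rho2 r).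
    by rewrite /rho2; field; rewrite gt_eqF.
  by rewrite CS subrr mulr0 mul0r.
- by rewrite rho20 psi0 ln1; ring.
- by rewrite rho20 psi0 ln1; ring.
Qed.

End generating_function.

(** * Asymptotics of the characteristic function of a step *)

Lemma le_normr_series_tail (R : realType) (f b : nat -> R) (N : nat) :
  (forall j, `|f j| <= b j) -> cvgn (series b) ->
  `|limn (series f) - series f N| <= limn (series b) - series b N.
Proof.
move=> fb cb.
have cf : cvgn (series f).
  apply: normed_cvg; apply: (series_le_cvg _ _ fb cb) => j;
    first exact: normr_ge0.
  by rewrite (le_trans _ (fb j)).
have c1 : `|series f m - series f N| @[m --> \oo] --> `|limn
  (series f) - series f N|.
  by apply: cvg_norm; apply: cvgB => //; exact: cvg_cst.
have c2 : series b m - series b N @[m --> \oo] --> limn (series b) - series b N.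
  by apply: cvgB => //; exact: cvg_cst.
apply: (ler_cvg_to c1 c2); near=> m.
have Nm : (N <= m)%N by near: m; exact: nbhs_infty_ge.
rewrite !sub_series_geq// (le_trans (ler_norm_sum _ _ _))//.
by apply: ler_sum => j _.
Unshelve. all: by end_near. Qed.

(** Tannery's theorem: two tails are controlled by [b] uniformly in [n], and the finite part
    converges termwise. *)
Lemma cvg_series_dominated (R : realType) (u : nat -> nat -> R) (v b : nat -> R) :
  (forall n j, `|u n j| <= b j) -> cvgn (series b) ->
  (forall j, u n j @[n --> \oo] --> v j) ->
  limn (series (u n)) @[n --> \oo] --> limn (series v).
Proof.
move=> ub cb uv.
have vb j : `|v j| <= b j.
  apply: (ler_cvg_to (cvg_norm (uv j)) (cvg_cst (b j))).
  by apply: nearW => n; exact: ub.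
apply/cvgrPdist_le => e e0; have e3 : 0 < e / 3 by rewrite divr_gt0.
have [N _ /(_ N (leqnn N)) bN] : \forall N \near \oo, `|limn
  (series b) - series b N| <= e / 3.
  by move/cvgrPdist_le : cb; apply.
have fin : series (u n) N @[n --> \oo] --> series v N.
  elim: (N) => [|k IH].
    by rewrite /series/=; under eq_fun do rewrite big_geq//;
      rewrite big_geq//; exact: cvg_cst.
  by under eq_fun do rewrite seriesSr; rewrite seriesSr; exact: cvgD.
move/cvgrPdist_le : fin => /(_ _ e3); apply: filterS => n hn.
have t1 := le_normr_series_tail N vb cb.
have t2 := le_normr_series_tail N (ub n) cb.
have t3 := le_trans (ler_norm _) bN.
rewrite (_ : _ - _ = (limn (series v) - series v N) +
  (series v N - series (u n) N)
  - (limn (series (u n)) - series (u n) N)); last by ring.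
rewrite (le_trans (ler_normB _ _))// (le_trans (lerD (ler_normD _ _) (lexx _)))//.
lra.
Qed.

(** Under absolute convergence, passing to the boundary is dominated convergence of series along r_n
    = 1 - 1 / (n + 1). *)
Lemma abel_limit (R : realType) (a : nat -> R) (F : R -> R) :
  cvgn (series (fun j => `|a j|)) ->
  (forall r, 0 <= r < 1 -> limn (pseries a r) = F r) ->
  {for 1, continuous F} -> limn (series a) = F 1.
Proof.
move=> ca aF cF.
pose r (n : nat) : R := 1 - harmonic n.
have r01 n : 0 <= r n < 1.
  by rewrite subr_ge0 invf_le1 ?ltr0n// ler1n/= gtrBl invr_gt0.
have r1 : r n @[n --> \oo] --> (1 : R).
  rewrite -[X in _ --> X]subr0; apply: cvgB; first exact: cvg_cst.
  exact: cvg_harmonic.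
have h1 : limn (pseries a (r n)) @[n --> \oo] --> F 1.
  under eq_fun do rewrite aF//.
  exact: (cvg_comp _ _ r1 cF).
apply: (cvg_unique _ _ h1) => //.
apply: (cvg_series_dominated (b := fun j => `|a j|)) => //.
- move=> n j; have /andP[r0 r1'] := r01 n;
  rewrite normrM ler_piMr// ger0_norm ?exprn_ge0//.
  by rewrite exprn_ile1// ltW.
- move=> j; rewrite -[X in _ --> X]mulr1; apply: cvgM; first exact: cvg_cst.
  rewrite -(expr1n _ j).
  exact: (cvg_comp _ _ r1 (@exprn_continuous R j 1)).
Qed.

Lemma cos_half (R : realType) (s : R) : cos s = 1 - 2 * sin (s / 2) ^+ 2.
Proof.
by rewrite [in LHS](splitr s) cosD -!expr2 cos2sin2; ring.
Qed.

Lemma sin_half (R : realType) (s : R) : sin s = 2 * sin (s / 2) * cos (s / 2).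
Proof. by rewrite [in LHS](splitr s) sinD; ring. Qed.

(** The quotient is the cotangent of s / 2, that is tan(pi / 2 - s / 2). It gives the argument of 1
    - z at the boundary. *)
Lemma atan_sin_div1Bcos (R : realType) (s : R) : 0 < s < pi ->
  atan (sin s / (1 - cos s)) = (pi - s) / 2.
Proof.
move=> /andP[s0 spi].
have sh0 : 0 < sin (s / 2).
  by apply: sin_gt0_pi; rewrite divr_gt0//= ltr_pdivrMr//; lra.
rewrite -[RHS]tanK; last by rewrite in_itv/=; apply/andP; split; lra.
congr atan; rewrite (_ : (pi - s) / 2 = pi / 2 - s / 2); last by ring.
rewrite /tan sinB cosB sin_pihalf cos_pihalf cos_half sin_half.
rewrite !(mul1r, mul0r) subr0 add0r opprB addrC subrK.
by field; rewrite gt_eqF.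
Qed.

(** * Boundary values of the generating function *)

Section step_char_closed_form.
Context (R : realType) (p : int -> R) (alpha : R).
Hypothesis fold_ge0 : forall j, 0 <= fold_law p j.
Hypothesis fold_sum : series (fold_law p) @ \oo --> (1 : R).
Hypothesis pS : forall j : nat,
  j.+3%:R * p j.+2%:Z = (j.+2%:R - alpha) * p j.+1%:Z.

(** The shift by one turns [pS] into (j + 1) q_(j+1) = (j - alpha) q_j, whose left side is a
    coefficient of the derivative. *)
Let q (j : nat) : R := if (j < 2)%N then 0 else p j.-1%:Z.

Let qS j : (2 <= j)%N -> j.+1%:R * q j.+1 = (j%:R - alpha) * q j.
Proof. by case: j => [|[|j]]// _; rewrite /q/= pS. Qed.

Let q_fold j : `|q j| <= if j == 0%N then 0 else fold_law p j.-1.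
Proof.
case: j => [|[|j]]; rewrite /q/= ?normr0//.
by have := fold_ge0 j.+1; rewrite /fold_law/= => h; rewrite ger0_norm; lra.
Qed.

Let cvg_q : cvgn (series (fun j => `|q j|)).
Proof.
apply: (series_le_cvg _ _ q_fold) => [j|j|]; first exact: normr_ge0.
  by case: ifP.
apply/cvg_ex; exists 1; rewrite -(cvg_shiftS _ _) /=.
apply: cvg_trans fold_sum; apply: near_eq_cvg; apply: nearW => n.
by rewrite /series/= big_nat_recl//= add0r.
Qed.

Let qM j : `|q j| <= 1.
Proof.
apply: le_trans (q_fold j) _; case: j => [|j]//=.
rewrite -(cvg_lim _ fold_sum)//; apply: le_trans (nondecreasing_cvgn_le _ _ j.+1).
- by rewrite /series/= big_nat_recr//= lerDr sumr_ge0.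
- by apply/nondecreasing_seqP => n; rewrite seriesSr lerDl.
- by apply/cvg_ex; exists 1.
Qed.

(** Undoing the shift: cos(j s) = cos((j + 1) s - s), so the sum over j >= 1 is the real part of
    conj(z) F(1), doubled by symmetry. *)
Lemma step_charE (s : R) : step_char p s = p 0 +
  2 * (cos s * limn (series (fun j => q j * cos (j%:R * s))) +
       sin s * limn (series (fun j => q j * sin (j%:R * s)))).
Proof.
have ca : cvgn (series (fun j => q j * cos (j%:R * s))).
  apply: normed_cvg; apply: (series_le_cvg _ _ _ cvg_q) => j;
    [exact: normr_ge0|exact: normr_ge0|].
  by rewrite /= normrM ler_piMr// normr_cos_le1.
have cb : cvgn (series (fun j => q j * sin (j%:R * s))).
  apply: normed_cvg; apply: (series_le_cvg _ _ _ cvg_q) => j;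
    [exact: normr_ge0|exact: normr_ge0|].
  by rewrite /= normrM ler_piMr// normr_sin_le1.
apply/cvg_lim => //; rewrite -(cvg_shiftS _ _).
pose f1 j := q j * cos (j%:R * s); pose f2 j := q j * sin (j%:R * s).
have E n : series (fun j => fold_law p j * cos (s * j%:R)) n.+1 = p 0 +
  2 * (cos s * series f1 n.+2 + sin s * series f2 n.+2).
  elim: n => [|n IH].
    by rewrite !seriesSr /series/= !big_geq// /f1 /f2 /q /fold_law/= mulr0
      cos0; ring.
  rewrite seriesSr IH [series f1 n.+3]seriesSr [series f2 n.+3]seriesSr.
  rewrite (_ : cos (s * n.+1%:R) = cos (n.+2%:R * s - s)); last first.
    by congr cos; rewrite -(natr1 n.+1); ring.
  rewrite cosB /f1 /f2 /q /fold_law/=; ring.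
under eq_fun do rewrite E.
apply: cvgD; first exact: cvg_cst.
apply: cvgM; first exact: cvg_cst.
have shift2 f : cvgn (series f) -> series f n.+2 @[n --> \oo] --> limn (series f).
  by move=> cf; rewrite (cvg_shiftS (fun n =>
    series f n.+1)) (cvg_shiftS (series f)).
by apply: cvgD; (apply: cvgM; first exact: cvg_cst); exact: shift2.
Qed.

Section closed_form_at1.
Variable s : R.
Hypothesis s0pi : 0 < s < pi.

(** The modulus of 1 - exp(i s). *)
Let v := 2 * sin (s / 2).

Lemma sin_half_gt0 : 0 < v.
Proof.
move: s0pi => /andP[s0 spi]; rewrite mulr_gt0//; apply: sin_gt0_pi.
by rewrite divr_gt0//= ltr_pdivrMr//; lra.
Qed.

Let rho21 : 1 - 2 * 1 * cos s + 1 ^+ 2 = v ^+ 2.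
Proof. by rewrite cos_half /v; ring. Qed.

Let ln_rho21 : ln (1 - 2 * 1 * cos s + 1 ^+ 2) = 2 * ln v.
Proof. by rewrite rho21 lnXn ?sin_half_gt0// mulr_natl. Qed.

Let onem_cos_gt0 : 0 < 1 - cos s.
Proof.
rewrite cos_half opprB addrC subrK mulr_gt0// exprn_gt0//.
by have := sin_half_gt0; rewrite /v pmulr_rgt0.
Qed.

Let continuous_ln_rho2 : {for 1, continuous (fun r : R =>
  ln (1 - 2 * r * cos s + r ^+ 2))}.
Proof.
apply: (@continuous_comp _ _ _ (fun r : R => 1 - 2 * r * cos s + r ^+ 2) (@ln R)).
  apply/differentiable_continuous/derivable1_diffP.
  by have [] := is_derive_sqr_dist_circle (cos s) 1.
by apply: continuous_ln; rewrite rho21 exprn_gt0// sin_half_gt0.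
Qed.

Let continuous_psi : {for 1, continuous (fun r : R =>
  atan (r * sin s / (1 - r * cos s)))}.
Proof.
apply: (@continuous_comp _ _ _ (fun r : R =>
  r * sin s / (1 - r * cos s)) (@atan R)); last exact: continuous_atan.
apply: cvgM; first by apply: cvgM; [exact: cvg_id|exact: cvg_cst].
apply: cvgV; first by rewrite mul1r gt_eqF.
by apply: cvgB; [exact: cvg_cst|apply: cvgM; [exact: cvg_id|exact: cvg_cst]].
Qed.

Let cvg_qcos : cvgn (series (fun j => `|q j * cos (j%:R * s)|)).
Proof.
apply: (series_le_cvg _ _ _ cvg_q) => j; [exact: normr_ge0|exact: normr_ge0|].
by rewrite /= normrM ler_piMr// normr_cos_le1.
Qed.

Let cvg_qsin : cvgn (series (fun j => `|q j * sin (j%:R * s)|)).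
Proof.
apply: (series_le_cvg _ _ _ cvg_q) => j; [exact: normr_ge0|exact: normr_ge0|].
by rewrite /= normrM ler_piMr// normr_sin_le1.
Qed.

Let continuous_linear1 (a b : R) : {for 1, continuous (fun r : R => a * r * b)}.
Proof. by apply: cvgM; [apply: cvgM;
  [exact: cvg_cst|exact: cvg_id]|exact: cvg_cst]. Qed.

Let continuous_pow_cos : {for 1, continuous (fun r : R =>
  expR (alpha / 2 * ln (1 - 2 * r * cos s + r ^+ 2)) *
  cos (alpha * atan (r * sin s / (1 - r * cos s))))}.
Proof.
apply: cvgM.
  apply: (@cvg_comp _ _ _ _ (@expR R)); last exact: continuous_expR.
  by apply: cvgM; [exact: cvg_cst|exact: continuous_ln_rho2].
apply: (@cvg_comp _ _ _ _ (@cos R)); last exact: continuous_cos.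
by apply: cvgM; [exact: cvg_cst|exact: continuous_psi].
Qed.

Let continuous_pow_sin : {for 1, continuous (fun r : R =>
  expR (alpha / 2 * ln (1 - 2 * r * cos s + r ^+ 2)) *
  sin (alpha * atan (r * sin s / (1 - r * cos s))))}.
Proof.
apply: cvgM.
  apply: (@cvg_comp _ _ _ _ (@expR R)); last exact: continuous_expR.
  by apply: cvgM; [exact: cvg_cst|exact: continuous_ln_rho2].
apply: (@cvg_comp _ _ _ _ (@sin R)); last exact: continuous_sin.
by apply: cvgM; [exact: cvg_cst|exact: continuous_psi].
Qed.

Let continuous_half_ln : {for 1, continuous (fun r : R =>
  ln (1 - 2 * r * cos s + r ^+ 2) / 2)}.
Proof. by apply: cvgM; [exact: continuous_ln_rho2|exact: cvg_cst]. Qed.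

Let continuous_1B : {for 1, continuous (fun r : R => 1 - r * cos s)}.
Proof.
apply: cvgB; first exact: cvg_cst.
by apply: cvgM; [exact: cvg_id|exact: cvg_cst].
Qed.

Let continuous_rM (b : R) : {for 1, continuous (fun r : R => r * b)}.
Proof. by apply: cvgM; [exact: cvg_id|exact: cvg_cst]. Qed.

(** With 1 - z = v exp(- i (pi - s) / 2), this is the real part of conj(z) F(1) = K (conj(z) (1 -
    z)^alpha - conj(z) + alpha). *)
Lemma step_char_powE (K : R) : K * (alpha * (alpha - 1)) = 2 * p 1 ->
  step_char p s = p 0 +
  2 * K * (v `^ alpha * cos (alpha * ((pi - s) / 2) + s) - cos s + alpha).
Proof.
move=> KE.
have GF := @generating_function_powE R q alpha s 1 erefl erefl qS qM K KE.
rewrite step_charE.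
rewrite (abel_limit cvg_qcos (fun r h => (GF r h).1)); last first.
  apply: cvgM; first exact: cvg_cst.
  apply: cvgD; last exact: continuous_linear1.
  by apply: cvgB; [exact: continuous_pow_cos|exact: cvg_cst].
rewrite (abel_limit cvg_qsin (fun r h => (GF r h).2)); last first.
  apply: cvgM; first exact: cvg_cst.
  by apply: cvgD; [apply: cvgN; exact: continuous_pow_sin|exact:
    continuous_linear1].
rewrite ln_rho21 !mul1r atan_sin_div1Bcos// cosD.
rewrite /powR gt_eqF ?sin_half_gt0//.
rewrite (_ : alpha / 2 * (2 * ln v) = alpha * ln v); last by field.
have e := cos2Dsin2 s.
transitivity (p 0 + 2 * K * (expR (alpha * ln v) * (cos (alpha *
  ((pi - s) / 2)) * cos s - sin (alpha * ((pi - s) / 2)) * sin s) - cos s +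
    alpha * (cos s ^+ 2 + sin s ^+ 2))).
  by ring.
by rewrite e mulr1.
Qed.

(** Here conj(z) F(1) = 2 p_1 (1 + (conj(z) - 1) log(1 - z)), with log(1 - z) = ln v - i (pi - s) /
    2. *)
Lemma step_char_logE : alpha = 1 ->
  step_char p s = p 0 +
  2 * (2 * p 1) * (1 - (1 - cos s) * ln v - (pi - s) / 2 * sin s).
Proof.
move=> a1.
have GF := @generating_function_logE R q alpha s 1 erefl erefl qS qM a1.
rewrite step_charE.
rewrite (abel_limit cvg_qcos (fun r h => (GF r h).1)); last first.
  apply: cvgM; first exact: cvg_cst.
  apply: cvgB; last by apply: cvgM; [exact: continuous_rM|exact: continuous_psi].
  apply: cvgD; first exact: continuous_rM.
  by apply: cvgM; [exact: continuous_1B|exact: continuous_half_ln].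
rewrite (abel_limit cvg_qsin (fun r h => (GF r h).2)); last first.
  apply: cvgM; first exact: cvg_cst.
  apply: cvgB; last by apply: cvgM;
    [exact: continuous_rM|exact: continuous_half_ln].
  apply: cvgB; first exact: continuous_rM.
  by apply: cvgM; [exact: continuous_1B|exact: continuous_psi].
rewrite ln_rho21 !mul1r atan_sin_div1Bcos//.
rewrite (_ : 2 * ln v / 2 = ln v); last by field.
have e : sin s ^+ 2 = 1 - cos s ^+ 2 by rewrite -(cos2Dsin2 s) addrC addKr.
transitivity (p 0 + 2 * (2 * p 1) * (1 - (1 - cos s) * ln v - (pi - s) / 2 *
  sin s + (1 - ln v) * (sin s ^+ 2 - (1 - cos s ^+ 2)))).
  by rewrite /q/=; ring.
by rewrite e subrr mulr0 addr0.
Qed.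

End closed_form_at1.

End step_char_closed_form.

(** * Elementary limits at 0 from the right *)

Lemma cvg_id_at_right0 (R : realType) : s @[s --> (0:R)^'+] --> (0 : R).
Proof. by apply: cvg_at_right_filter; exact: cvg_id. Qed.

Lemma cvg_sin_half_div (R : realType) :
  2 * sin (s / 2) / s @[s --> (0:R)^'+] --> (1 : R).
Proof.
have half0 : x / 2 @[x --> (0:R)^'+] --> (0 : R).
  rewrite -[X in _ --> X](mul0r 2^-1); apply: cvgM; last exact: cvg_cst.
  exact: cvg_id_at_right0.
apply: (@lhopital_at_right R (fun s => 2 * sin (s / 2)) (fun s =>
  cos (s / 2)) id (fun=> 1) 0 1).
- exact: ltr01.
- by move=> x _; apply: is_derive_eq; rewrite /GRing.scale/=; field.
- rewrite -[X in _ --> X](mulr0 2); apply: cvgM; first exact: cvg_cst.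
  by have := cvg_comp _ _ half0 (@continuous_sin R 0); rewrite sin0.
- exact: cvg_id_at_right0.
- by move=> x _; rewrite oner_eq0.
- under eq_fun do rewrite divr1.
  by have := cvg_comp _ _ half0 (@continuous_cos R 0); rewrite cos0.
Qed.

Lemma near_0pi (R : realType) : \forall s \near (0:R)^'+, 0 < s < pi.
Proof.
near=> s; apply/andP; split; first by near: s; exact: nbhs_right_gt.
by near: s; apply: nbhs_right_lt; exact: pi_gt0.
Unshelve. all: by end_near. Qed.

Lemma cvg_ln_sin_half_div (R : realType) :
  ln (2 * sin (s / 2) / s) @[s --> (0:R)^'+] --> (0 : R).
Proof.
have h1 : 0 < 1 :> R by [].
by have := cvg_comp _ _ (@cvg_sin_half_div R) (continuous_ln h1); rewrite ln1.
Qed.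

Lemma cvg_1Bcos_div (R : realType) (b : R) : b < 2 ->
  (1 - cos s) / s `^ b @[s --> (0:R)^'+] --> (0 : R).
Proof.
move=> b2.
have h : (2 * sin (s / 2) / s) ^+ 2 / 2 *
  s `^ (2 - b) @[s --> (0:R)^'+] --> (0 : R).
  rewrite -[X in _ --> X](mulr0 (1 ^+ 2 / 2)); apply: cvgM; last first.
    by apply: powR_cvg0; rewrite subr_gt0.
  apply: cvgM; last exact: cvg_cst.
  exact: (cvg_comp _ _ (@cvg_sin_half_div R) (@exprn_continuous R 2 1)).
apply: cvg_trans h; apply: near_eq_cvg; near=> s.
have s0 : 0 < s by near: s; exact: nbhs_right_gt.
rewrite powRB ?(gt_eqF s0) ?implybT// powR_mulrn ?ltW// cos_half.
by field; rewrite !gt_eqF ?powR_gt0.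
Unshelve. all: by end_near. Qed.

Lemma cvg_1Bcos_div2 (R : realType) :
  (1 - cos s) / s `^ 2 @[s --> (0:R)^'+] --> (2^-1 : R).
Proof.
have h : (2 * sin (s / 2) / s) ^+ 2 / 2 @[s --> (0:R)^'+] --> (1 ^+ 2 / 2 : R).
  apply: cvgM; last exact: cvg_cst.
  exact: (cvg_comp _ _ (@cvg_sin_half_div R) (@exprn_continuous R 2 1)).
rewrite expr1n mul1r in h.
apply: cvg_trans h; apply: near_eq_cvg; near=> s.
have s0 : 0 < s by near: s; exact: nbhs_right_gt.
rewrite powR_mulrn ?ltW// cos_half.
by field; rewrite gt_eqF.
Unshelve. all: by end_near. Qed.

Lemma cvg_pow_sin_half_div (R : realType) (alpha : R) :
  (2 * sin (s / 2)) `^ alpha / s `^ alpha @[s --> (0:R)^'+] --> (1 : R).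
Proof.
have h : expR (alpha * ln (2 * sin (s / 2) / s)) @[s --> (0:R)^'+] --> expR
  (alpha * 0).
  have h0 : alpha * ln (2 * sin (s / 2) / s) @[s --> (0:R)^'+] --> alpha * 0.
    by apply: cvgM; [exact: cvg_cst|exact: cvg_ln_sin_half_div].
  exact: (cvg_comp _ _ h0 (@continuous_expR R _)).
rewrite mulr0 expR0 in h; apply: cvg_trans h; apply: near_eq_cvg; near=> s.
have s0pi : 0 < s < pi by near: s; exact: near_0pi.
have v0 := sin_half_gt0 s0pi; have /andP[s0 _] := s0pi.
rewrite ln_div ?posrE// /powR !gt_eqF// mulrBr expRD expRN.
by [].
Unshelve. all: by end_near. Qed.

Lemma cvg_mul_ln0 (R : realType) : s * ln s @[s --> (0:R)^'+] --> (0 : R).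
Proof.
apply: norm_cvg0.
have h : 2 * s `^ (2^-1) @[s --> (0:R)^'+] --> (0 : R).
  rewrite -[X in _ --> X](mulr0 2); apply: cvgM; first exact: cvg_cst.
  exact: powR_cvg0.
apply: (squeeze_cvgr _ (cvg_cst 0) h); near=> s.
have s0 : 0 < s by near: s; exact: nbhs_right_gt.
have s1 : s < 1 by near: s; exact: nbhs_right_lt.
(* With y the square root of s, - ln s = 2 ln(1 / y) <= 2 / y, which bounds |s ln s| by 2 y. *)
pose y := s `^ 2^-1; have y0 : 0 < y by exact: powR_gt0.
have sE : s = y ^+ 2 by rewrite -powR_mulrn ?ltW// -powRrM mulVf// powRr1// ltW.
rewrite normr_ge0/= -/y normrM (ger0_norm (ltW s0)) ler0_norm;
  last exact/ln_le0/ltW.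
rewrite {2}sE lnXn// -mulNrn -lnV ?posrE// -[y^-1](addrNK 1) addrC.
have yV : -1 < y^-1 - 1 by rewrite ltrBrDr addNr invr_gt0.
rewrite (@le_trans _ _ (s * (y^-1 *+ 2)))//.
  rewrite ler_wpM2l ?(ltW s0)// lerMn2r/= (le_trans (le_ln1Dx yV))//.
  by rewrite gerBl.
rewrite {1}sE (_ : y ^+ 2 * (y^-1 *+ 2) = 2 * y)//.
by field; rewrite gt_eqF.
Unshelve. all: by end_near. Qed.

Lemma gen_binomialS (R : realType) (alpha : R) (k : nat) :
  k.+1%:R * gen_binomial alpha k.+1 = (alpha - k%:R) * gen_binomial alpha k.
Proof.
rewrite /gen_binomial big_ord_recr/= factS natrM; field.
by rewrite nat1r !pnatr_eq0 -lt0n fact_gt0.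
Qed.

Lemma step_prob_sym (R : realType) (alpha mu : R) (k : int) :
  step_prob alpha mu (- k) = step_prob alpha mu k.
Proof. by rewrite /step_prob oppr_eq0 abszN. Qed.

(** One recurrence covers the three laws; for alpha = 2 the factor 2 - alpha at j = 0 ends the
    sequence after the first term. *)
Lemma step_prob_rec (R : realType) (alpha mu : R) (j : nat) :
  j.+3%:R * step_prob alpha mu j.+2%:Z =
  (j.+2%:R - alpha) * step_prob alpha mu j.+1%:Z.
Proof.
rewrite /step_prob; case: eqP => [->|_] /=.
  have pi0 : pi != 0 :> R by rewrite gt_eqF// pi_gt0.
  rewrite -(natr1 j.+2) -(natr1 j.+1); move: pi pi0 => c c0; field.
  by rewrite c0 !nat1r !natr1 !pnatr_eq0.
case: eqP => [->|_] /=.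
  by case: j => [|j]; rewrite /= ?mulr0 ?subrr ?mul0r.
by rewrite mulrCA gen_binomialS exprS; ring.
Qed.

Lemma step_char_asymptotics (R : realType) (alpha mu : R) :
  0 < alpha -> alpha <= 2 -> 0 < mu -> mu <= step_bound alpha ->
  (forall j, 0 <= fold_law (step_prob alpha mu) j) ->
  series (fold_law (step_prob alpha mu)) @ \oo --> (1 : R) ->
  (1 - step_char (step_prob alpha mu) s) / s `^ alpha @[s --> (0:R)^'+] --> mu.
Proof.
move=> alpha0 alpha2 mu0 mub fold_ge0 fold_sum.
have rec := step_prob_rec alpha mu.
have pi0 : pi != 0 :> R by rewrite gt_eqF// pi_gt0.
have half0 : x / 2 @[x --> (0:R)^'+] --> (0 / 2 : R).
  by apply: cvgM; [exact: cvg_id_at_right0|exact: cvg_cst].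
have [a1|a1] := eqVneq alpha 1.
  have p0 : step_prob alpha mu 0 = 1 - 2 * mu / pi by rewrite /step_prob a1 eqxx.
  have p1 : step_prob alpha mu 1 = mu / (2 * pi).
    by rewrite /step_prob a1 eqxx/=; move: pi pi0 => q q0; field.
  (* The value of [p 0] cancels the constant of the closed form. Splitting ln v = ln(v / s) + ln s
     makes the logarithmic term vanish, and the sine term tends to pi / 2. *)
  have h : 2 * mu / pi * ((2 * sin (s / 2) / s) ^+ 2 / 2 * (s * ln (2 *
    sin (s / 2) / s) + s * ln s) +
      (pi - s) / 2 * (2 * sin (s / 2) / s) * cos (s / 2)) @[s --> (0:R)^'+]
     --> 2 * mu / pi * (1 ^+ 2 / 2 * (0 * 0 + 0) + (pi - 0) / 2 * 1 * cos 0).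
    apply: cvgM; first exact: cvg_cst.
    apply: cvgD; apply: cvgM.
    - apply: cvgM; last exact: cvg_cst.
      exact: (cvg_comp _ _ (@cvg_sin_half_div R) (@exprn_continuous R 2 1)).
    - apply: cvgD; last exact: cvg_mul_ln0.
      by apply: cvgM; [exact: cvg_id_at_right0|exact: cvg_ln_sin_half_div].
    - apply: cvgM; last exact: cvg_sin_half_div.
      apply: cvgM; last exact: cvg_cst.
      by apply: cvgB; [exact: cvg_cst|exact: cvg_id_at_right0].
    - rewrite mul0r in half0.
      exact: (cvg_comp _ _ half0 (@continuous_cos R 0)).
  rewrite (_ : 2 * mu / pi * _ = mu) in h; last by rewrite cos0;
    move: pi pi0 => q q0; field.
  apply: cvg_trans h; apply: near_eq_cvg; near=> s.
  have s0pi : 0 < s < pi by near: s; exact: near_0pi.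
  have v0 := sin_half_gt0 s0pi; have /andP[s0 _] := s0pi.
  rewrite (step_char_logE fold_ge0 fold_sum rec s0pi a1) p0 p1 a1 powRr1
    ?(ltW s0)//.
  rewrite ln_div ?posrE// (cos_half s) (sin_half s).
  have := gt_eqF s0; move: (cos (s / 2)) (sin (s / 2)) (ln (2 *
    _)) (ln s) pi pi0 => a b e f q q0 /negbT sn0; field.
  by rewrite q0 sn0.
have [a2|a2] := eqVneq alpha 2.
  have char2 (s : R) : step_char (step_prob alpha mu) s =
    1 - 2 * mu * (1 - cos s).
    apply: cvg_lim => //; apply: (@cvg_trans _ (1 - 2 * mu *
      (1 - cos s) @[n --> \oo])); last exact: cvg_cst.
    apply: near_eq_cvg; near=> n.
    have n2 : (2 <= n)%N by near: n; exact: nbhs_infty_ge.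
    rewrite /series/= -(subnK n2) addn2 !big_nat_recl// big1 => [|j _].
      rewrite /fold_law/= /step_prob (negbTE a1) a2 eqxx/= mulr0 cos0 !mulr1.
      ring.
    by rewrite /fold_law/= /step_prob (negbTE a1) a2 eqxx/= mulr0 mul0r.
  have h : 2 * mu * ((1 - cos s) / s `^ 2) @[s --> (0:R)^'+] --> 2 * mu * 2^-1.
    by apply: cvgM; [exact: cvg_cst|exact: cvg_1Bcos_div2].
  rewrite mulrAC mulfV ?mul1r ?pnatr_eq0// in h.
  apply: cvg_trans h; apply: near_eq_cvg; near=> s.
  by rewrite char2 a2 subKr mulrA.
have a2' : alpha < 2 by rewrite lt_neqAle a2.
pose c := cos (alpha * pi / 2).
(* If [c] vanished, so would [step_bound alpha], against 0 < mu. *)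
have c0 : c != 0.
  apply/eqP => c0; move: mub; rewrite /step_bound (negbTE a1)
    (negbTE a2) -/c c0 mul0r.
  by rewrite leNgt mu0.
have p0 : step_prob alpha mu 0 = 1 - 2 * mu * ((1 - alpha) / (2 * c)).
  by rewrite /step_prob (negbTE a1) (negbTE a2) eqxx.
have p1 : step_prob alpha mu 1 = - (mu / (2 * c)) * (alpha * (alpha - 1) / 2).
  rewrite /step_prob (negbTE a1) (negbTE a2)/= expr1 mulN1r; congr (_ * _).
  by rewrite /gen_binomial !big_ord_recl big_ord0 mulr1 subr0.
pose K := - (mu / (2 * c)).
have KE : K * (alpha * (alpha - 1)) = 2 * step_prob alpha mu 1.
  by rewrite p1 /K; field.
(* Since 2 K = - mu / c, the terms 1 - p_0 and 2 K alpha add up to leave mu / c (v^alpha cos(...) +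
   1 - cos s); the limit of the cosine is [c], which cancels the denominator. *)
have h : mu / c * ((2 * sin (s / 2)) `^ alpha / s `^ alpha * cos (alpha *
  ((pi - s) / 2) + s) +
   (1 - cos s) / s `^ alpha) @[s --> (0:R)^'+] --> mu / c * (1 * cos (alpha *
     ((pi - 0) / 2) + 0) + 0).
  apply: cvgM; first exact: cvg_cst.
  apply: cvgD; last exact: cvg_1Bcos_div.
  apply: cvgM; first exact: cvg_pow_sin_half_div.
  have : alpha * ((pi - s) / 2) + s @[s --> (0:R)^'+] --> alpha *
    ((pi - 0) / 2) + 0.
    apply: cvgD; last exact: cvg_id_at_right0.
    apply: cvgM; first exact: cvg_cst.
    apply: cvgM; last exact: cvg_cst.
    by apply: cvgB; [exact: cvg_cst|exact: cvg_id_at_right0].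
  by move=> /(cvg_comp _ _)/(_ (@continuous_cos R _)).
rewrite (_ : mu / c * _ = mu) in h; last first.
  by rewrite subr0 !addr0 mul1r mulrA -/c divfK.
apply: cvg_trans h; apply: near_eq_cvg; near=> s.
have s0pi : 0 < s < pi by near: s; exact: near_0pi.
have /andP[s0 _] := s0pi.
rewrite (step_char_powE fold_ge0 fold_sum rec s0pi KE) p0 /K.
have := gt_eqF (powR_gt0 alpha s0);
  move: (powR s _) (powR (2 * _) _) (cos (_ + _)) (cos s) =>
    a b e f /negbT sn0; field.
by rewrite c0 sn0.
Unshelve. all: by end_near.
Qed.

(** * Passage to the limit *)

(** The hypothesis forces [c n] to tend to 1, so [c n] is eventually positive and has a logarithm.
    The bound ln(1 + y) <= y at c - 1 and at 1 / c - 1 encloses n ln c between - n (1 - c) / c and -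
    n (1 - c). *)
Lemma cvg_expr_seq (R : realType) (c : nat -> R) (x : R) :
  n%:R * (1 - c n) @[n --> \oo] --> x -> c n ^+ n @[n --> \oo] --> expR (- x).
Proof.
move=> cx.
have c1 : c n @[n --> \oo] --> (1 : R).
  rewrite -cvg_shiftS /=.
  have h : 1 - n.+1%:R^-1 * (n.+1%:R * (1 - c n.+1)) @[n --> \oo] --> 1 - 0 * x.
    apply: cvgB; first exact: cvg_cst.
    by apply: cvgM; [exact: cvg_harmonic|rewrite -cvg_shiftS in cx].
  rewrite mul0r subr0 in h; apply: cvg_trans h; apply: near_eq_cvg; near=> n.
  by rewrite mulKf ?pnatr_eq0// subKr.
have c_gt0 : \forall n \near \oo, 0 < c n by apply: (cvgr_gt _ c1); exact: ltr01.
have h : n%:R * ln (c n) @[n --> \oo] --> - x.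
  apply: (@squeeze_cvgr _ _ _ _ (fun n => - (n%:R * (1 - c n) / c n))
     (fun n => - (n%:R * (1 - c n)))).
  - near=> n.
    have cn0 : 0 < c n by near: n.
    rewrite -mulrA -!mulrN !ler_wpM2l//.
      have := @le_ln1Dx R (c n - 1); rewrite (addrC 1) subrK opprB; apply.
      by rewrite ltrBrDl subrr.
    have := @le_ln1Dx R ((c n)^-1 - 1); rewrite (addrC 1) subrK lnV ?posrE//.
    rewrite ltrBrDl subrr invr_gt0 cn0 => /(_ isT).
    by rewrite mulrN mulrBl divff ?gt_eqF// mul1r lerNl.
  - rewrite -[X in _ --> - X](divr1 x); apply: cvgN; apply: cvgM => //.
    exact: cvgV (oner_neq0 _) c1.
  - exact: cvgN.
have := cvg_comp _ _ h (@continuous_expR R (- x)).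
apply: cvg_trans; apply: near_eq_cvg; near=> n.
by rewrite /= expRM_natl lnK// posrE; near: n.
Unshelve. all: by end_near.
Qed.

Lemma step_char_abs (R : realType) (p : int -> R) (k : R) :
  step_char p `|k| = step_char p k.
Proof.
case: (ger0P k) => // _; rewrite /step_char.
by under eq_fun do rewrite mulNr cosN.
Qed.

Lemma cvg_powR_seq0 (R : realType) (alpha : R) (h : nat -> R) :
  0 < alpha -> (forall n, 0 < h n) ->
  h n `^ alpha @[n --> \oo] --> (0 : R) -> h @ \oo --> (0 : R).
Proof.
move=> alpha0 h0 hc; apply/cvgr0Pnorm_lt => e e0.
have ea0 : 0 < e `^ alpha by rewrite powR_gt0.
have /cvgr0Pnorm_lt/(_ _ ea0) := hc; apply: filterS => n.
rewrite !ger0_norm ?powR_ge0 ?(ltW (h0 n))// => he.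
rewrite ltNge; apply/negP => /(ge0_ler_powR (ltW alpha0)).
by rewrite leNgt he => /(_ (ltW e0) (ltW (h0 n))).
Qed.

(** * Integrability of the stable characteristic function *)

Lemma integrable_oneDsqrV (R : realType) :
  lebesgue_measure.-integrable setT (EFin \o (fun x : R => (1 + x ^+ 2)^-1)).
Proof.
have c := @continuous_oneDsqrV R.
apply/integrableP; split.
  by apply/measurable_EFinP; exact: continuous_measurable_fun c.
under eq_integral => x _ do
  rewrite /= ger0_norm ?invr_ge0 ?addr_ge0 ?sqr_ge0//.
rewrite (ge0_symfun_integralT (f := fun x : R => (1 + x ^+ 2)^-1))//.
- rewrite (_ : [set x | _] = `[0, +oo[%classic); last first.
    by apply/seteqP; split => x/=; rewrite in_itv/= andbT.
  by rewrite integral0y_oneDsqr -EFinM ltry.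
- by move=> x; rewrite invr_ge0 addr_ge0 ?sqr_ge0.
- by move=> x /=; rewrite sqrrN.
Qed.

(** Raise y <= exp y, at y = t u / (m + 1), to the power m + 1. *)
Lemma le_powR_expR (R : realType) (t u : R) (m : nat) :
  0 < t -> 0 <= u -> u ^+ m.+1 <= (m.+1%:R / t) ^+ m.+1 * expR (t * u).
Proof.
move=> t0 u0; have tm : 0 < t / m.+1%:R by rewrite divr_gt0.
rewrite -[X in expR X](@divfK _ m.+1%:R) ?pnatr_eq0// expRM_natr -exprMn.
rewrite lerXn2r ?nnegrE ?mulr_ge0 ?expR_ge0 ?invr_ge0 ?(ltW t0)//.
rewrite -ler_pdivrMl ?divr_gt0// invf_div mulrAC.
apply: le_trans (expR_ge1Dx _); rewrite mulrAC.
by rewrite lerDr.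
Qed.

Lemma integrable_stable_char (R : realType) (alpha t : R) :
  0 < alpha -> 0 < t ->
  lebesgue_measure.-integrable setT
    (EFin \o (fun k : R => expR (- (t * `|k| `^ alpha)))).
Proof.
move=> alpha0 t0.
pose m := Num.bound (2 / alpha).
have ma : 2 <= alpha * m.+1%:R.
  rewrite -ler_pdivrMl// mulrC; apply/ltW.
  apply: lt_trans (archi_boundP _) _; first by rewrite divr_ge0 ?(ltW alpha0).
  by rewrite ltr_nat.
(* For |k| <= 1 the constant 2 bounds 1 + k^2. For |k| > 1 the choice alpha (m + 1) >= 2 gives k^2
   <= (|k|^alpha)^(m+1), to which [le_powR_expR] applies. *)
pose C := 2 + (m.+1%:R / t) ^+ m.+1.
have iC : lebesgue_measure.-integrable setT
    (EFin \o (fun x : R => C * (1 + x ^+ 2)^-1)).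
  exact: (integrable_EFinZl C measurableT (@integrable_oneDsqrV R)).
apply: (@integrable_le _ _ R lebesgue_measure setT _ (fun x : R =>
  C * (1 + x ^+ 2)^-1)) => //.
  apply: (measurableT_comp (@measurable_expR R)).
  apply: measurable_funN; apply: measurable_funM => //.
  exact: (measurableT_comp (measurable_powR alpha) (@normr_measurable R setT)).
move=> k _; rewrite ger0_norm ?expR_ge0// expRN.
have d0 : 0 < 1 + k ^+ 2 by rewrite ltr_pwDl ?sqr_ge0.
rewrite ler_pdivlMr// ler_pdivrMl ?expR_gt0//.
have e1 : 1 <= expR (t * `|k| `^ alpha).
  by rewrite -[leLHS]expR0 ler_expR mulr_ge0 ?powR_ge0 ?(ltW t0).
have q0 : 0 <= (m.+1%:R / t) ^+ m.+1 by rewrite exprn_ge0// divr_ge0 ?(ltW t0).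
rewrite /C mulrDr.
have [k1|k1] := lerP `|k| 1.
  have : k ^+ 2 <= 1 by rewrite -real_normK ?num_real// expr_le1.
  have := mulr_ge0 (expR_ge0 (t * `|k| `^ alpha)) q0; lra.
have k2 : k ^+ 2 <= (`|k| `^ alpha) ^+ m.+1.
  rewrite -[_ ^+ m.+1]powR_mulrn ?powR_ge0// -powRrM -real_normK ?num_real//.
  by rewrite -(powR_mulrn 2)// ler_powR// ltW.
have := le_powR_expR m t0 (powR_ge0 `|k| alpha); rewrite (mulrC (_ ^+ _)).
lra.
Qed.

Lemma stable_density_cos (R : realType) (alpha t x : R) :
  stable_density alpha t x =
  (2 * pi)^-1 * \int[lebesgue_measure]_k
    (cos (k * x) * expR (- (t * `|k| `^ alpha))).
Proof.
rewrite /stable_density /stable_integral /complex_integral /=.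
rewrite mul0r subr0; congr (_ * _); apply: eq_Rintegral => k _.
by rewrite /= mulr0 subr0 cosN.
Qed.

Theorem theorem6p1 (R : realType) (alpha mu t : R)
    (halpha0 : 0 < alpha) (halpha2 : alpha <= 2)
    (hmu0 : 0 < mu) (hmu : mu <= step_bound alpha)
    (ht : 0 < t)
    (d : measure_display) (T : measurableType d) (P : probability T R)
    (Y : nat -> {RV P >-> int})
    (hindep : mutually_independent Y)
    (hlaw : forall (m : nat) (k : int),
       P (Y m @^-1` [set k]) = (step_prob alpha mu k)%:E)
    (h : nat -> R)
    (hpos : forall n : nat, (0 < n)%N -> 0 < h n)
    (hscale : forall n : nat, (0 < n)%N -> t / n%:R = mu * h n `^ alpha)
    (d' : measure_display) (T' : measurableType d') (P' : probability T' R)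
    (S : {RV P' >-> R})
    (hS : has_density S (stable_density alpha t)) :
  cvg_in_distribution (fun n : nat => scaled_walk (h n) Y n : {RV P >-> R}) S.
Proof.
pose p := step_prob alpha mu.
have psym : forall k, p (- k) = p k by move=> k; exact: step_prob_sym.
have p_ge0 : forall j, 0 <= fold_law p j by move=> j;
  exact: (fold_law_ge0 hlaw psym).
have p_sum : series (fold_law p) @ \oo --> (1 : R) by exact:
  (cvg_series_fold_law hlaw psym).
(* Indices are shifted because nothing is assumed about [h 0]. *)
have scaleE n : h n.+1 `^ alpha = t / mu * n.+1%:R^-1.
  by rewrite mulrAC hscale// mulrAC divff ?mul1r// gt_eqF.
have h0 : (fun n => h n.+1) @ \oo --> (0 : R).
  apply: (cvg_powR_seq0 halpha0) => [n|]; first exact: hpos.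
  under eq_fun do rewrite scaleE.
  have : t / mu * n.+1%:R^-1 @[n --> \oo] --> t / mu * 0.
    by apply: cvgM; [exact: cvg_cst|exact: cvg_harmonic].
  by rewrite mulr0.
have asym (k : R) : n%:R * (1 - step_char p (k * h n)) @[n --> \oo] -->
    t * `|k| `^ alpha.
  rewrite -cvg_shiftS.
  (* A limit at 0 from the right says nothing at the point 0 itself, so the frequency 0 is treated
     apart. *)
  have [->|k0] := eqVneq k 0.
    rewrite normr0 powR0 ?gt_eqF// mulr0.
    have char0 : step_char p 0 = 1.
      apply: cvg_lim => //; under [X in series X]eq_fun do rewrite mul0r cos0
        mulr1.
      exact: p_sum.
    apply: cvg_near_cst; apply: nearW => n.
    by rewrite /= mul0r char0 subrr mulr0.
  have k_gt0 : 0 < `|k| by rewrite normr_gt0.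
  pose u n := `|k| * h n.+1.
  have u0 n : 0 < u n by rewrite mulr_gt0 ?hpos.
  have ul : u @ \oo --> (0 : R).
    have : u @ \oo --> `|k| * 0 by apply: cvgM => //; exact: cvg_cst.
    by rewrite mulr0.
  have /cvg_at_rightP/(_ u (conj u0 ul)) H :=
    step_char_asymptotics halpha0 halpha2 hmu0 hmu p_ge0 p_sum.
  (* With u = |k| h, the scaling relation gives n u^alpha = |k|^alpha t / mu, so n (1 - c(u)) is
     this constant times the quotient whose limit is mu. *)
  have H' : `|k| `^ alpha * (t / mu) *
    ((1 - step_char p (u n)) / u n `^ alpha) @[n --> \oo]
      --> `|k| `^ alpha * (t / mu) * mu.
    by apply: cvgM; [exact: cvg_cst|exact: H].
  rewrite (_ : _ * mu = t * `|k| `^ alpha) in H'; last first.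
    by rewrite -mulrA divfK ?gt_eqF// mulrC.
  apply: cvg_trans H'; apply: near_eq_cvg; near=> n.
  rewrite /u /= powRM ?normr_ge0 ?(ltW (hpos _ _))// scaleE.
  rewrite -[in RHS]step_char_abs normrM (gtr0_norm (hpos _ _))//.
  move: (step_char _ _) => c.
  have ka0 : `|k| `^ alpha != 0 by rewrite gt_eqF ?powR_gt0.
  field.
  by rewrite ka0 !gt_eqF.
apply: (cvg_in_distribution_char hS (integrable_stable_char halpha0 ht)).
  exact: stable_density_cos.
move=> k th.
have : cos th * step_char p (k * h n) ^+ n @[n --> \oo] -->
    cos th * expR (- (t * `|k| `^ alpha)).
  by apply: cvgM; [exact: cvg_cst|exact: cvg_expr_seq].
apply: cvg_trans; apply: near_eq_cvg; near=> n.
(* With no index in [J] the cylinder is the whole space, of probability 1. *)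
have nJ : forall j, j \in (fset0 : {fset nat}) -> (n <= j)%N by [].
have := Rintegral_cos_walk hindep hlaw psym (k * h n) th (fun=> setT) nJ.
rewrite (_ : \bigcap_(j in _) _ = setT); last first.
  by rewrite -subTset => w _ j; rewrite /= inE.
rewrite probability_setT /= mulr1 => <-.
by apply: eq_Rintegral => w _; rewrite /scaled_walk mulrA.
Unshelve. all: by end_near.
Qed.
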